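(* Let $f,g,A,\mathcal Z,x^0,z^0$ satisfy the Assumption stated in the context, and consider the BC-ADMM iteration (defined in the context) for the problem $\min_{x\in\mathbb R^n,\,z\in\mathcal Z} f(x)+g(Ax,z)$. Then for sufficiently large $\beta_x,\beta_y,\beta$ (that is: there are thresholds $B_x,B_y>0$ such that for all $\beta_x\ge B_x$ and $\beta_y\ge B_y$ there is a threshold $B>0$, possibly depending on $\beta_x,\beta_y$, such that the following holds for all $\beta\ge B$), every sequence generated by BC-ADMM satisfies: (1) $f(x^k)+g(Ax^k,z^k)<\infty$ for every $k\ge 0$; (2) BC-ADMM converges to an $\epsilon$-stationary solution of the problem with an oracle complexity of $O(\epsilon^{-2})$: there is a constant $C$ independent of $\epsilon$ such that for every $\epsilon\in(0,1]$ there is an iteration index $k\le C\epsilon^{-2}$ for which $(x^k,z^k)$ is an $\epsilon$-stationary solution.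
   Context: Notation. $\mathbb R^+=[0,\infty)$; extended-real functions are continuous as maps into $[0,\infty]$; $\mathrm{dom}(h)=\{h<\infty\}$; $A\in\mathbb R^{m\times n}$; $\mathcal Z\subseteq\mathbb R^l$; $\iota_{\mathcal Z}$ is the indicator function ($0$ on $\mathcal Z$, $\infty$ elsewhere). A function $h$ on (a product of) Euclidean spaces is coercive if $h\to\infty$ as the norm of its argument tends to $\infty$. For $r,M>0$ let $$\mathcal S_{\mathcal Z}(r,M)=\{(y,z)\in\mathbb R^{m}\times\mathbb R^{l}: g(y,z)\le M,\ \|(y,z)\|\le r,\ z\in\mathcal Z\}.$$ Assumption. i) $f:\mathbb R^n\to\mathbb R^+\cup\{\infty\}$ is continuous, and differentiable in $\mathrm{dom}(f)$; $g:\mathbb R^{m+l}\to\mathbb R^+\cup\{\infty\}$ is continuous, and twice continuously differentiable in $\mathrm{dom}(g)$. ii) $(x,z)\mapsto f(x)+g(Ax,z)$ is coercive. iii) A strictly feasible $x^0\in\mathbb R^n$, $z^0\in\mathcal Z$ is given, i.e. $f(x^0)+g(Ax^0,z^0)<\infty$. iv) $g(\cdot,z)$ is convex for every $z$. vi) $\mathcal Z$ is closed. For all $r,M>0$: whenever $(y,z)\in\mathcal S_{\mathcal Z}(r,M)$, the function $g(y,\cdot)+\iota_{\mathcal Z}(\cdot)$ has a unique global minimizer, denoted $z(y)$, and $(y,z(y))\in\mathcal S_{\mathcal Z}(\bar r_{zy}^{r,M},M)$ for some finite constant $\bar r_{zy}^{r,M}$ depending only on $r,M$. Further, on the set of $y$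 with $(y,z(y))\in\mathcal S_{\mathcal Z}(r,M)$, the map $y\mapsto z(y)$ is $L_{zy}^{r,M}$-Lipschitz continuous for some finite $L_{zy}^{r,M}$. BC-ADMM. With parameters $\beta,\beta_x,\beta_y>0$ let $$\mathcal L(x,y,z,\lambda)=f(x)+g(y,z)+\tfrac{\beta}{2}\|Ax-y\|^2+\lambda^T(Ax-y).$$ Initialize $y^0=Ax^0$, $z^0=z(y^0)$ (replacing the given $z^0$), $\lambda^0=\nabla_y g(y^0,z^0)$, and iterate for $k=0,1,2,\dots$ $$\begin{aligned} x^{k+1}&=\operatorname{argmin}_x\ \mathcal L(x,y^k,z^k,\lambda^k)+\tfrac{\beta_x}{2}\|x-x^k\|^2,\\ y^{k+1}&=\operatorname{argmin}_y\ \mathcal L(x^{k+1},y,z^k,\lambda^k)+\tfrac{\beta_y}{2}\|y-y^k\|^2,\\ z^{k+1}&=\operatorname{argmin}_{z\in\mathcal Z}\ \mathcal L(x^{k+1},y^{k+1},z,\lambda^k)=z(y^{k+1}),\\ \lambda^{k+1}&=\lambda^k+\beta(Ax^{k+1}-y^{k+1}). \end{aligned}$$ In the $x$-step, $x^{k+1}$ is only required to be a locally optimal solution computed by a descent method started at $x^k$ (so it satisfies the first-order optimality condition and its objective value is at most the value at $x^k$); the $y$- and $z$-steps are solved to global optimality. Each subproblem solve counts as one oracle call, so oracle complexity is measured by the number of iterations. $\epsilon$-stationarity. $(x,z)$ with $z\in\mathcal Z$ is an $\epsilon$-stationary solution if $\|\nabla f(x)+A^T\nabla_y g(Ax,z)\|\le\epsilon$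 and $\mathrm{dist}\big(N_{\mathcal Z}(z),-\nabla_z g(Ax,z)\big)\le\epsilon$, where $N_{\mathcal Z}(z)$ is the (limiting) normal cone of $\mathcal Z$ at $z$. *)

(* Defs.v *)
From HB Require Import structures.
From mathcomp Require Import all_boot all_order all_algebra.
From mathcomp Require Import all_classical all_reals all_analysis.

Set Implicit Arguments.
Unset Strict Implicit.
Unset Printing Implicit Defensive.

Import Order.TTheory GRing.Theory Num.Theory.
Import numFieldNormedType.Exports.

Local Open Scope classical_set_scope.
Local Open Scope ring_scope.

(* The library norm on matrices is the sup norm, hence [enorm]; it induces the
   same topology, so limits, continuity and differentiability below are the
   library's.  A pair (u, v) of vectors is encoded as [col_mx u v]. *)
Definition dot (R : realType) (n : nat) (u v : 'cV[R]_n) : R :=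
  \sum_(i < n) u i 0 * v i 0.

Definition enorm (R : realType) (n : nat) (u : 'cV[R]_n) : R :=
  Num.sqrt (dot u u).

Definition edom (T : Type) (R : realType) (h : T -> \bar R) : set T :=
  [set t | (h t < +oo)%E].

Definition indic_fun (R : realType) (T : Type) (D : set T) (t : T) : \bar R :=
  if `[< D t >] then 0%E else +oo%E.

Definition argmin_on (R : realType) (T : Type) (D : set T) (h : T -> \bar R)
    (t : T) : Prop :=
  D t /\ forall t', D t' -> (h t <= h t')%E.

(* The gradient of an extended-real function is that of [fine \o h]; it is only
   meaningful on the (open) domain of h. *)
Definition rgrad (R : realType) (n : nat) (h : 'cV[R]_n -> R) (x : 'cV[R]_n) :
    'cV[R]_n :=
  \col_(i < n) 'D_(delta_mx i 0) h x.

Definition grad (R : realType) (n : nat) (h : 'cV[R]_n -> \bar R)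
    (x : 'cV[R]_n) : 'cV[R]_n :=
  rgrad (fine \o h) x.

Definition hessian (R : realType) (n : nat) (h : 'cV[R]_n -> R)
    (x : 'cV[R]_n) : 'M[R]_n :=
  \matrix_(i < n, j < n) 'D_(delta_mx j 0) (fun p => rgrad h p i 0) x.

Definition differentiable_on (R : realType) (n : nat) (h : 'cV[R]_n -> R)
    (D : set 'cV[R]_n) : Prop :=
  forall x, D x -> differentiable h x.

Definition twice_cont_differentiable_on (R : realType) (n : nat)
    (h : 'cV[R]_n -> R) (D : set 'cV[R]_n) : Prop :=
  forall x, D x ->
    [/\ differentiable h x, differentiable (rgrad h) x
      & {for x, continuous (hessian h)}].

Definition grad_y (R : realType) (m l : nat) (g : 'cV[R]_(m + l) -> \bar R)
    (y : 'cV[R]_m) (z : 'cV[R]_l) : 'cV[R]_m :=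
  usubmx (grad g (col_mx y z)).

Definition grad_z (R : realType) (m l : nat) (g : 'cV[R]_(m + l) -> \bar R)
    (y : 'cV[R]_m) (z : 'cV[R]_l) : 'cV[R]_l :=
  dsubmx (grad g (col_mx y z)).

Definition econvex (R : realType) (n : nat) (h : 'cV[R]_n -> \bar R) : Prop :=
  forall (u v : 'cV[R]_n) (t : R), 0 <= t -> t <= 1 ->
    (h (t *: u + (1 - t) *: v)%R <= t%:E * h u + (1 - t)%R%:E * h v)%E.

Definition coercive (R : realType) (n : nat) (h : 'cV[R]_n -> \bar R) : Prop :=
  forall M : R, exists rho : R,
    forall u, rho < enorm u -> (M%:E < h u)%E.

(* Regular (Frechet) normals: <v, z' - z> <= o(|z' - z|) for z' in Z. *)
Definition regular_normal (R : realType) (l : nat) (Z : set 'cV[R]_l)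
    (z v : 'cV[R]_l) : Prop :=
  Z z /\ forall e : R, 0 < e ->
    \forall z' \near z, Z z' -> dot v (z' - z) <= e * enorm (z' - z).

Definition limiting_normal_cone (R : realType) (l : nat) (Z : set 'cV[R]_l)
    (z : 'cV[R]_l) : set 'cV[R]_l :=
  [set v | Z z /\ exists zs vs : nat -> 'cV[R]_l,
    [/\ forall k, regular_normal Z (zs k) (vs k),
        zs @ \oo --> z & vs @ \oo --> v]].

Definition edist (R : realType) (l : nat) (N : set 'cV[R]_l) (v : 'cV[R]_l) :
    \bar R :=
  ereal_inf [set (enorm (u - v)%R)%:E | u in N].

Definition Sset (R : realType) (m l : nat) (g : 'cV[R]_(m + l) -> \bar R)
    (Z : set 'cV[R]_l) (r M : R) (y : 'cV[R]_m) (z : 'cV[R]_l) : Prop :=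
  [/\ (g (col_mx y z) <= M%:E)%E, enorm (col_mx y z) <= r & Z z].

Definition zargmin (R : realType) (m l : nat) (g : 'cV[R]_(m + l) -> \bar R)
    (Z : set 'cV[R]_l) (y : 'cV[R]_m) : set 'cV[R]_l :=
  argmin_on setT (fun z => g (col_mx y z) + indic_fun R Z z)%E.

(* z(y): meaningful only when [zargmin g Z y] is a singleton. *)
Definition zmap (R : realType) (m l : nat) (g : 'cV[R]_(m + l) -> \bar R)
    (Z : set 'cV[R]_l) (y : 'cV[R]_m) : 'cV[R]_l :=
  get (zargmin g Z y).

Record bc_assumption (R : realType) (n m l : nat)
    (f : 'cV[R]_n -> \bar R) (g : 'cV[R]_(m + l) -> \bar R)
    (A : 'M[R]_(m, n)) (Z : set 'cV[R]_l)
    (x0 : 'cV[R]_n) (z0 : 'cV[R]_l) : Prop := BcAssumption {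
  bc_f_ge0 : forall x, (0 <= f x)%E;
  bc_f_cont : continuous f;
  bc_f_diff : differentiable_on (fine \o f) (edom f);
  bc_g_ge0 : forall p, (0 <= g p)%E;
  bc_g_cont : continuous g;
  bc_g_C2 : twice_cont_differentiable_on (fine \o g) (edom g);
  bc_coercive : coercive (fun p : 'cV[R]_(n + l) =>
    f (usubmx p) + g (col_mx (A *m usubmx p)%R (dsubmx p)))%E;
  bc_z0 : Z z0;
  bc_feasible : (f x0 + g (col_mx (A *m x0)%R z0) < +oo)%E;
  bc_convex : forall z, econvex (fun y => g (col_mx y z));
  bc_Z_closed : closed Z;
  bc_zmap : forall r M : R, 0 < r -> 0 < M ->
    exists rbar : R, forall y z, Sset g Z r M y z ->
      (exists! w, zargmin g Z y w) /\ Sset g Z rbar M y (zmap g Z y);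
  bc_zmap_lip : forall r M : R, 0 < r -> 0 < M ->
    exists L : R, forall y1 y2,
      Sset g Z r M y1 (zmap g Z y1) -> Sset g Z r M y2 (zmap g Z y2) ->
      enorm (zmap g Z y1 - zmap g Z y2) <= L * enorm (y1 - y2)
}.

Definition lagrangian (R : realType) (n m l : nat)
    (f : 'cV[R]_n -> \bar R) (g : 'cV[R]_(m + l) -> \bar R)
    (A : 'M[R]_(m, n)) (beta : R)
    (x : 'cV[R]_n) (y : 'cV[R]_m) (z : 'cV[R]_l) (lam : 'cV[R]_m) : \bar R :=
  (f x + g (col_mx y z)
   + (beta / 2 * enorm (A *m x - y) ^+ 2 + dot lam (A *m x - y))%R%:E)%E.

Definition x_objective (R : realType) (n m l : nat)
    (f : 'cV[R]_n -> \bar R) (g : 'cV[R]_(m + l) -> \bar R)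
    (A : 'M[R]_(m, n)) (beta betax : R)
    (xk : 'cV[R]_n) (y : 'cV[R]_m) (z : 'cV[R]_l) (lam : 'cV[R]_m)
    (x : 'cV[R]_n) : \bar R :=
  (lagrangian f g A beta x y z lam + (betax / 2 * enorm (x - xk) ^+ 2)%R%:E)%E.

Definition y_objective (R : realType) (n m l : nat)
    (f : 'cV[R]_n -> \bar R) (g : 'cV[R]_(m + l) -> \bar R)
    (A : 'M[R]_(m, n)) (beta betay : R)
    (x : 'cV[R]_n) (yk : 'cV[R]_m) (z : 'cV[R]_l) (lam : 'cV[R]_m)
    (y : 'cV[R]_m) : \bar R :=
  (lagrangian f g A beta x y z lam + (betay / 2 * enorm (y - yk) ^+ 2)%R%:E)%E.

(* The x-step returns a local minimizer reached by descent from x k; the y- and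
   z-steps return global minimizers. *)
Record bc_admm (R : realType) (n m l : nat)
    (f : 'cV[R]_n -> \bar R) (g : 'cV[R]_(m + l) -> \bar R)
    (A : 'M[R]_(m, n)) (Z : set 'cV[R]_l) (x0 : 'cV[R]_n) (beta betax betay : R)
    (x : nat -> 'cV[R]_n) (y : nat -> 'cV[R]_m) (z : nat -> 'cV[R]_l)
    (lam : nat -> 'cV[R]_m) : Prop := BcAdmm {
  bc_x_init : x 0%N = x0;
  bc_y_init : y 0%N = A *m x0;
  bc_z_init : z 0%N = zmap g Z (y 0%N);
  bc_lam_init : lam 0%N = grad_y g (y 0%N) (z 0%N);
  bc_x_local : forall k,
    let obj := x_objective f g A beta betax (x k) (y k) (z k) (lam k) in
    \forall x' \near x k.+1, (obj (x k.+1) <= obj x')%E;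
  bc_x_descent : forall k,
    let obj := x_objective f g A beta betax (x k) (y k) (z k) (lam k) in
    (obj (x k.+1) <= obj (x k))%E;
  bc_y_step : forall k,
    argmin_on setT (y_objective f g A beta betay (x k.+1) (y k) (z k) (lam k))
      (y k.+1);
  bc_z_step : forall k,
    argmin_on Z (fun z' => lagrangian f g A beta (x k.+1) (y k.+1) z' (lam k))
      (z k.+1);
  bc_lam_step : forall k,
    lam k.+1 = lam k + beta *: (A *m x k.+1 - y k.+1)
}.

(* Finiteness of the objective is required for the gradients to make sense. *)
Definition eps_stationary (R : realType) (n m l : nat)
    (f : 'cV[R]_n -> \bar R) (g : 'cV[R]_(m + l) -> \bar R)
    (A : 'M[R]_(m, n)) (Z : set 'cV[R]_l) (eps : R)
    (x : 'cV[R]_n) (z : 'cV[R]_l) : Prop :=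
  [/\ Z z, (f x + g (col_mx (A *m x)%R z) < +oo)%E,
      enorm (grad f x + A^T *m grad_y g (A *m x) z) <= eps
    & (edist (limiting_normal_cone Z z) (- grad_z g (A *m x) z)%R <= eps%:E)%E].

(* Main.v *)
(** Write [u k] for [A x k - y k].  The y-step makes the multiplier explicit,
    [lam (k+1) = grad_y g (y (k+1)) (z k) + betay (y (k+1) - y k)], so on a fixed
    compact set [|lam (k+1) - lam k|] is at most a constant, independent of
    [beta], times [|y (k+1) - y k| + |y k - y (k-1)|].  Hence
    [L(x, y, z, lam) + (c / beta) |y k - y (k-1)|^2] decreases by at least
    [(betax / 2) |x (k+1) - x k|^2 + (betay / 4) |y (k+1) - y k|^2] once [beta] is
    large.  The iterates never leave the compact set: descent bounds
    [f (x (k+1))], [g (y (k+1)) (z k)] and [|y (k+1) - y k|], the assumption on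
    [z(.)] then bounds [z (k+1)], and the gap
    [|u (k+1)| = |lam (k+1) - lam k| / beta] is so small that
    [g (A x (k+1)) (z (k+1))] is at most 1 above the bound on
    [g (y (k+1)) (z (k+1))]; coercivity turns this into the bound on
    [(x (k+1), z (k+1))] needed at the next step.  The stationarity residuals are
    linear in the steps, whose squares are summable, which gives the rate. *)
Require Import Defs.
From HB Require Import structures.
From mathcomp Require Import all_boot all_order all_algebra.
From mathcomp Require Import all_classical all_reals all_analysis.
From mathcomp Require Import ring lra.

Set Implicit Arguments.
Unset Strict Implicit.
Unset Printing Implicit Defensive.

Import Order.TTheory GRing.Theory Num.Theory.
Import numFieldNormedType.Exports.

Local Open Scope classical_set_scope.
Local Open Scope ring_scope.

(** * The Euclidean inner product and norm on column vectors *)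

Lemma dotC (R : realType) n (u v : 'cV[R]_n) : dot u v = dot v u.
Proof. by apply: eq_bigr => i _; rewrite mulrC. Qed.

Lemma dotDl (R : realType) n (u v w : 'cV[R]_n) :
  dot (u + v) w = dot u w + dot v w.
Proof. by rewrite -big_split; apply: eq_bigr => i _; rewrite mxE mulrDl. Qed.

Lemma dotZl (R : realType) n (a : R) (u w : 'cV[R]_n) :
  dot (a *: u) w = a * dot u w.
Proof. by rewrite mulr_sumr; apply: eq_bigr => i _; rewrite mxE mulrA. Qed.

Lemma dotNl (R : realType) n (u w : 'cV[R]_n) : dot (- u) w = - dot u w.
Proof. by rewrite -scaleN1r dotZl mulN1r. Qed.

Lemma dotBl (R : realType) n (u v w : 'cV[R]_n) :
  dot (u - v) w = dot u w - dot v w.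
Proof. by rewrite dotDl dotNl. Qed.

Lemma dotDr (R : realType) n (u v w : 'cV[R]_n) :
  dot w (u + v) = dot w u + dot w v.
Proof. by rewrite !(dotC w) dotDl. Qed.

Lemma dotZr (R : realType) n (a : R) (u w : 'cV[R]_n) :
  dot w (a *: u) = a * dot w u.
Proof. by rewrite !(dotC w) dotZl. Qed.

Lemma dotNr (R : realType) n (u w : 'cV[R]_n) : dot w (- u) = - dot w u.
Proof. by rewrite !(dotC w) dotNl. Qed.

Lemma dotBr (R : realType) n (u v w : 'cV[R]_n) :
  dot w (u - v) = dot w u - dot w v.
Proof. by rewrite dotDr dotNr. Qed.

Lemma dot0l (R : realType) n (u : 'cV[R]_n) : dot 0 u = 0.
Proof. by rewrite /dot big1 // => i _; rewrite mxE mul0r. Qed.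

Lemma dot0r (R : realType) n (u : 'cV[R]_n) : dot u 0 = 0.
Proof. by rewrite dotC dot0l. Qed.

Lemma dot_delta (R : realType) n (u : 'cV[R]_n) i :
  dot u (delta_mx i 0) = u i 0.
Proof.
rewrite /dot (bigD1 i) //= big1 ?addr0 => [|j /negbTE ji]; last first.
  by rewrite mxE ji mulr0.
by rewrite mxE !eqxx mulr1.
Qed.

Lemma dot_tr (R : realType) m n (A : 'M[R]_(m, n)) (u : 'cV[R]_m) v :
  dot (A^T *m u) v = dot u (A *m v).
Proof.
rewrite /dot.
under eq_bigr do rewrite mxE mulr_suml.
rewrite exchange_big /=; apply: eq_bigr => i _.
rewrite mxE mulr_sumr; apply: eq_bigr => j _.
by rewrite mxE; ring.
Qed.

Lemma dot_ge0 (R : realType) n (u : 'cV[R]_n) : 0 <= dot u u.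
Proof. by apply: sumr_ge0 => i _; rewrite -expr2 sqr_ge0. Qed.

Lemma enorm_ge0 (R : realType) n (u : 'cV[R]_n) : 0 <= enorm u.
Proof. exact: sqrtr_ge0. Qed.

Lemma enorm_sqr (R : realType) n (u : 'cV[R]_n) : enorm u ^+ 2 = dot u u.
Proof. by rewrite sqr_sqrtr // dot_ge0. Qed.

Lemma enorm_le_of_sqr (R : realType) n (u : 'cV[R]_n) (a : R) :
  0 <= a -> dot u u <= a ^+ 2 -> enorm u <= a.
Proof. by move=> a0; rewrite -enorm_sqr ler_sqr ?nnegrE ?enorm_ge0. Qed.

Lemma enorm0 (R : realType) n : enorm (0 : 'cV[R]_n) = 0.
Proof. by rewrite /enorm dot0l sqrtr0. Qed.

Lemma enormZ (R : realType) n a (u : 'cV[R]_n) : enorm (a *: u) = `|a| * enorm u.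
Proof.
by rewrite /enorm dotZl dotZr mulrA -expr2 sqrtrM ?sqr_ge0 // sqrtr_sqr.
Qed.

Lemma enormN (R : realType) n (u : 'cV[R]_n) : enorm (- u) = enorm u.
Proof. by rewrite /enorm dotNl dotNr opprK. Qed.

Lemma enorm_distC (R : realType) n (u v : 'cV[R]_n) :
  enorm (u - v) = enorm (v - u).
Proof. by rewrite -enormN opprB. Qed.

Lemma coord_le_enorm (R : realType) n (u : 'cV[R]_n) i : `|u i 0| <= enorm u.
Proof.
rewrite -sqrtr_sqr; apply: ler_wsqrtr.
rewrite /dot (bigD1 i) //= -expr2 lerDl sumr_ge0 // => j _.
by rewrite -expr2 sqr_ge0.
Qed.

Lemma enorm_eq0 (R : realType) n (u : 'cV[R]_n) : enorm u = 0 -> u = 0.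
Proof.
move=> u0; apply/matrixP => i j; rewrite ord1 mxE; apply/eqP.
by rewrite -normr_le0 -u0 coord_le_enorm.
Qed.

Lemma cauchy_schwarz (R : realType) n (u v : 'cV[R]_n) :
  dot u v <= enorm u * enorm v.
Proof.
have [v0|vN0] := eqVneq (enorm v) 0.
  by rewrite (enorm_eq0 v0) enorm0 mulr0 dot0r.
have [u0|uN0] := eqVneq (enorm u) 0.
  by rewrite (enorm_eq0 u0) enorm0 mul0r dot0l.
have up : 0 < enorm u by rewrite lt_def uN0 enorm_ge0.
have vp : 0 < enorm v by rewrite lt_def vN0 enorm_ge0.
(* Expanding this square gives [2 a b (a b - d) >= 0], where [a], [b] are the norms and [d] is the
   inner product. *)
have := dot_ge0 (enorm v *: u - enorm u *: v).
rewrite !(dotBl, dotBr, dotZl, dotZr) -!enorm_sqr (dotC v u).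
set a := enorm u in up *; set b := enorm v in vp *; set d := dot u v => H.
have : 0 <= 2 * (a * b) * (a * b - d) by nra.
by rewrite pmulr_rge0 ?subr_ge0 // !mulr_gt0.
Qed.

Lemma cauchy_schwarz_lower (R : realType) n (u v : 'cV[R]_n) :
  - (enorm u * enorm v) <= dot u v.
Proof. by have := cauchy_schwarz (- u) v; rewrite dotNl enormN lerNl. Qed.

Lemma enormD (R : realType) n (u v : 'cV[R]_n) :
  enorm (u + v) <= enorm u + enorm v.
Proof.
apply: enorm_le_of_sqr; first by rewrite addr_ge0 ?enorm_ge0.
rewrite dotDl !dotDr (dotC v u) -!enorm_sqr.
by have := cauchy_schwarz u v; nra.
Qed.

Lemma enorm_triangle (R : realType) n (u v w : 'cV[R]_n) :
  enorm (u - w) <= enorm (u - v) + enorm (v - w).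
Proof. by rewrite -[u - w](_ : (u - v) + (v - w) = _) ?enormD // addrA subrK. Qed.

Lemma enorm_lerD (R : realType) n (u v : 'cV[R]_n) :
  enorm u <= enorm v + enorm (u - v).
Proof. by rewrite -{1}(subrK v u) addrC enormD. Qed.

Lemma enorm_mulmx (R : realType) m n (A : 'M[R]_(m, n)) :
  exists2 a : R, 0 <= a & forall u, enorm (A *m u) <= a * enorm u.
Proof.
(* The constant is the Frobenius norm; Cauchy-Schwarz is applied row by row. *)
exists (Num.sqrt (\sum_i dot (row i A)^T (row i A)^T)) => [|u].
  exact: sqrtr_ge0.
apply: enorm_le_of_sqr; first by rewrite mulr_ge0 ?sqrtr_ge0 ?enorm_ge0.
rewrite exprMn sqr_sqrtr; last by apply: sumr_ge0 => i _; exact: dot_ge0.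
rewrite mulr_suml; apply: ler_sum => i _.
have -> : (A *m u) i 0 = dot (row i A)^T u.
  by rewrite mxE; apply: eq_bigr => j _; rewrite !mxE.
rewrite -enorm_sqr -exprMn -expr2 -[leLHS]real_normK ?num_real //.
rewrite ler_sqr ?nnegrE ?mulr_ge0 ?enorm_ge0 // ler_norml.
by rewrite cauchy_schwarz_lower cauchy_schwarz.
Qed.

(** * Comparison with the sup norm, neighbourhoods and compactness *)

Lemma norm_le_enorm (R : realType) n (u : 'cV[R]_n) : `|u| <= enorm u.
Proof.
rewrite [leLHS]/Num.norm /= mx_normrE; apply/bigmax_leP; split => [|[i j] _ /=].
  exact: enorm_ge0.
by rewrite ord1 coord_le_enorm.
Qed.

Lemma coord_le_norm (R : realType) n (u : 'cV[R]_n) i : `|u i 0| <= `|u|.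
Proof.
rewrite [leRHS]/Num.norm /= mx_normrE; apply/bigmax_geP; right.
by exists (i, 0).
Qed.

(** The factor [n.+1] is cruder than the square root of [n] but stays positive for [n = 0], so radii
    can be divided by it. *)
Lemma enorm_le_coord (R : realType) n (u : 'cV[R]_n) (a : R) :
  0 <= a -> (forall i, `|u i 0| <= a) -> enorm u <= n.+1%:R * a.
Proof.
move=> a0 ua; apply: enorm_le_of_sqr; first by rewrite mulr_ge0.
rewrite /dot (@le_trans _ _ (\sum_(i < n) a ^+ 2)) //.
  apply: ler_sum => i _.
  by rewrite -expr2 -[leLHS]real_normK ?num_real // ler_sqr ?nnegrE.
rewrite sumr_const card_ord -[leLHS]mulr_natl exprMn ler_wpM2r ?sqr_ge0 //.
rewrite -natrX ler_nat (@leq_trans n.+1) // -mulnn leq_pmulr //.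
Qed.

(** Equivalence of the two norms; it lets later epsilon-delta arguments use Euclidean balls. *)
Lemma nbhs_enormP (R : realType) n (p : 'cV[R]_n) (P : set 'cV[R]_n) :
  nbhs p P <-> exists2 d : R, 0 < d & forall q, enorm (q - p) < d -> P q.
Proof.
split=> [/(nbhs_normP p P).1[d /= d0 dP]|[d d0 dP]].
  exists d => // q qp; apply: dP => /=.
  by rewrite distrC (le_lt_trans (norm_le_enorm _)).
apply/(nbhs_normP p P).2; exists (d / n.+1%:R) => /=; first by rewrite divr_gt0.
move=> q /= pq; apply: dP.
rewrite enorm_distC (@le_lt_trans _ _ (n.+1%:R * `|p - q|)) //.
  by apply: enorm_le_coord => // i; exact: coord_le_norm.
by rewrite mulrC -ltr_pdivlMr.
Qed.

Lemma continuous_enorm (R : realType) n : continuous (@enorm R n).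
Proof.
move=> p; apply/(@cvgrPdist_lt _ _ _ _ (nbhs_filter p)) => e e0.
apply/nbhs_enormP; exists e => // q qp.
rewrite (le_lt_trans _ qp) // ler_norml.
have := enorm_lerD p q; have := enorm_lerD q p; rewrite (enorm_distC p q); lra.
Qed.

(** Heine-Borel is applied to row vectors: the set is carried over by transposition, which does not
    increase the sup norm. *)
Lemma compact_enorm_le (R : realType) n (D : set 'cV[R]_n) (r : R) :
  closed D -> compact (D `&` [set p | enorm p <= r]).
Proof.
move=> Dcl.
have trc k j : continuous (@trmx R k j).
  move=> M; apply/(@cvgrPdist_lt _ _ _ _ (nbhs_filter M)) => e e0.
  apply: (nbhs_normP M _).2; exists e => //= N.
  suff trn k' j' (P : 'M[R]_(k', j')) : `|P^T| <= `|P|.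
    by move=> MN; rewrite -linearB /=; apply: le_lt_trans (trn _ _ _) MN.
  rewrite [leLHS]/Num.norm [leRHS]/Num.norm /= !mx_normrE.
  apply/bigmax_leP; split => [|[i i'] _ /=].
    by apply/bigmax_geP; left.
  by rewrite mxE; apply/bigmax_geP; right; exists (i', i).
set K := _ `&` _.
have -> : K = trmx @` (trmx @^-1` K : set 'rV[R]_n).
  apply/seteqP; split => [p Kp|_ [p Kp <-]//].
  by exists p^T => /=; rewrite ?trmxK.
apply: continuous_compact; first exact/continuous_subspaceT/trc.
apply: bounded_closed_compact.
  exists r; split; first exact: num_real.
  move=> x rx p [_ /= pr]; apply: le_trans (ltW rx).
  apply: le_trans pr; apply: le_trans (norm_le_enorm _).
  rewrite [leLHS]/Num.norm [leRHS]/Num.norm /= !mx_normrE.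
  apply/bigmax_leP; split => [|[i i'] _ /=].
    by apply/bigmax_geP; left.
  by apply/bigmax_geP; right; exists (i', i); rewrite ?mxE.
apply: preimage_closed; first by move=> *; exact: trc.
apply: closedI => //.
apply: (preimage_closed (f := @enorm R n)) (@closed_le _ r) => x _.
exact: continuous_enorm.
Qed.

(** * First-order expansions *)

Lemma dot_diff (R : realType) n (h : 'cV[R]_n -> R) p v :
  differentiable h p -> 'd h p v = dot (rgrad h p) v.
Proof.
move=> dh; rewrite [v in LHS]matrix_sum_delta linear_sum; apply: eq_bigr => i _.
by rewrite big_ord1 linearZ /= mxE deriveE // mulrC.
Qed.

Lemma frechet (R : realType) n (h : 'cV[R]_n -> R) p (e : R) :
  differentiable h p -> 0 < e ->
  exists2 d : R, 0 < d & forall q, enorm (q - p) < d ->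
    `|h q - h p - dot (rgrad h p) (q - p)| <= e * enorm (q - p).
Proof.
move=> dh e0.
have /eqaddoP/(_ e e0)/nbhs_enormP[d d0 dP] :
    h \o shift p = cst (h p) + 'd h p +o_ (0 : 'cV[R]_n) id.
  exact: diff_locally.
exists d => // q qp.
have := dP (q - p); rewrite subr0 => /(_ qp).
rewrite /= !fctE /= subrK -dot_diff // opprD addrA => /le_trans; apply.
by rewrite ler_wpM2l ?norm_le_enorm // ltW.
Qed.

Lemma dot_inj (R : realType) n (u v : 'cV[R]_n) :
  (forall w, dot u w = dot v w) -> u = v.
Proof.
by move=> uv; apply/matrixP => i j; rewrite ord1 -!dot_delta uv.
Qed.

(** * Stacked vectors *)

Lemma dot_col_mx (R : realType) m l (u : 'cV[R]_m) (v : 'cV[R]_l) p :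
  dot p (col_mx u v) = dot (usubmx p) u + dot (dsubmx p) v.
Proof.
rewrite /dot big_split_ord /=; congr (_ + _); apply: eq_bigr => i _.
  by rewrite col_mxEu mxE.
by rewrite col_mxEd mxE.
Qed.

Lemma enorm_col_mx (R : realType) m l (u : 'cV[R]_m) (v : 'cV[R]_l) :
  enorm (col_mx u v) ^+ 2 = enorm u ^+ 2 + enorm v ^+ 2.
Proof. by rewrite !enorm_sqr dot_col_mx col_mxKu col_mxKd. Qed.

Lemma enorm_col_mx_le (R : realType) m l (u : 'cV[R]_m) (v : 'cV[R]_l) :
  enorm (col_mx u v) <= enorm u + enorm v.
Proof.
have u0 := enorm_ge0 u; have v0 := enorm_ge0 v.
rewrite -ler_sqr ?nnegrE ?enorm_ge0 ?addr_ge0 // enorm_col_mx; nra.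
Qed.

Lemma enorm_col_mxu (R : realType) m l (u : 'cV[R]_m) (v : 'cV[R]_l) :
  enorm u <= enorm (col_mx u v).
Proof.
by rewrite -ler_sqr ?nnegrE ?enorm_ge0 // enorm_col_mx lerDl sqr_ge0.
Qed.

Lemma enorm_col_mxd (R : realType) m l (u : 'cV[R]_m) (v : 'cV[R]_l) :
  enorm v <= enorm (col_mx u v).
Proof.
by rewrite -ler_sqr ?nnegrE ?enorm_ge0 // enorm_col_mx lerDr sqr_ge0.
Qed.

Lemma enorm_usubmx (R : realType) m l (p : 'cV[R]_(m + l)) :
  enorm (usubmx p) <= enorm p.
Proof. by rewrite -{2}(vsubmxK p) enorm_col_mxu. Qed.

Lemma enorm_dsubmx (R : realType) m l (p : 'cV[R]_(m + l)) :
  enorm (dsubmx p) <= enorm p.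
Proof. by rewrite -{2}(vsubmxK p) enorm_col_mxd. Qed.

(** * First-order optimality conditions *)

(** Testing [t = d / 2] and [t = - d / 2] and dividing by [d / 2] gives [|a| <= e] for every [e]. *)
Lemma linear_dominates_eq0 (R : realType) (a : R) :
  (forall e, 0 < e -> exists2 d, 0 < d &
    forall t, `|t| < d -> 0 <= t * a + e * `|t|) -> a = 0.
Proof.
move=> H; apply/eqP; rewrite -normr_le0; apply/ler_addgt0Pr => e e0.
have [d d0 dP] := H e e0; rewrite add0r.
have d2 : 0 < d / 2 by rewrite divr_gt0.
have P s : `|s| = 1 -> 0 <= s * a + e.
  move=> s1; have := dP (d / 2 * s).
  rewrite normrM s1 mulr1 gtr0_norm // => /(_ ltac:(lra)).
  have -> : d / 2 * s * a + e * (d / 2) = d / 2 * (s * a + e) by ring.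
  by rewrite pmulr_rge0.
rewrite ler_norml; apply/andP; split.
  by have := P 1 (normr1 _); lra.
by have := P (- 1) (normrN1 _); lra.
Qed.

(** Fermat's rule for [h] plus a quadratic penalty whose change along [w] is exactly
    [t * a + t ^+ 2 * b]. For small [t] the quadratic term and the differentiability error each cost
    at most [e / 2 * |t|]. *)
Lemma derive_at_min (R : realType) n (h : 'cV[R]_n -> R) p w (a b : R) :
  differentiable h p ->
  (exists2 d, 0 < d & forall t, `|t| < d ->
    h p <= h (p + t *: w) + (t * a + t ^+ 2 * b)) ->
  dot (rgrad h p) w = - a.
Proof.
move=> dh [d d0 dP]; apply/eqP; rewrite -addr_eq0; apply/eqP.
apply: linear_dominates_eq0 => e e0.
set c := enorm w + 1.
have c0 : 0 < c by rewrite ltr_wpDl ?enorm_ge0.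
have [d' d'0 d'P] := frechet dh (divr_gt0 e0 (mulr_gt0 (ltr0n _ 2) c0)).
set k := `|b| + 1.
have k0 : 0 < k by rewrite ltr_wpDl.
(* The three radii serve minimality, the expansion of [h] at [p + t *: w], and the bound on
   [t ^+ 2 * b]. *)
exists (Num.min d (Num.min (d' / c) (e / (2 * k)))) => [|t].
  by rewrite !lt_min d0 !divr_gt0 // mulr_gt0.
rewrite !lt_min ltr_pdivlMr // ltr_pdivlMr ?mulr_gt0 // => /and3P[td tc tk].
have t0 := normr_ge0 t.
have w0 := enorm_ge0 w.
have := d'P (p + t *: w).
rewrite (addrC p) addrK enormZ dotZr => /(_ _)/wrap[|].
  by apply: le_lt_trans tc; rewrite ler_wpM2l // lerDl.
have : e / (2 * c) * (`|t| * enorm w) <= e / 2 * `|t|.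
  have -> : e / (2 * c) * (`|t| * enorm w) = e / 2 * `|t| * (enorm w / c).
    by field; rewrite gt_eqF.
  rewrite ler_piMr ?mulr_ge0 ?invr_ge0 ?(ltW e0) //.
  by rewrite ler_pdivrMr // mul1r lerDl.
move=> /[swap] /le_trans /[apply]; rewrite ler_norml => /andP[_].
have := dP t td; rewrite (addrC p).
have : t ^+ 2 * b <= e / 2 * `|t|.
  apply: (@le_trans _ _ (`|t| * (`|t| * k))).
    rewrite mulrA -expr2 real_normK ?num_real // ler_wpM2l ?sqr_ge0 //.
    by rewrite (le_trans (ler_norm b)) // lerDl.
  by rewrite mulrC ler_wpM2r //; lra.
lra.
Qed.

(** The hypothesis makes [- v] a regular normal; constant sequences then place it in the limiting
    cone. *)
Lemma regular_normal_min (R : realType) l (Z : set 'cV[R]_l) (z v : 'cV[R]_l) :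
  Z z -> (forall e, 0 < e -> exists2 d, 0 < d & forall z', Z z' ->
    enorm (z' - z) < d -> - dot v (z' - z) <= e * enorm (z' - z)) ->
  limiting_normal_cone Z z (- v).
Proof.
move=> Zz H; split => //; exists (fun=> z), (fun=> - v).
split; [|exact: cvg_cst|exact: cvg_cst].
move=> _; split => // e e0; have [d d0 dP] := H e e0.
apply/nbhs_enormP; exists d => // z' zd Zz'; rewrite dotNl; exact: dP.
Qed.

(** * Lipschitz bounds on gradients, locally and on compact sets *)

(** The ball is convex, so the scalar mean value theorem applies to [h] along the segment from [q']
    to [q]; Cauchy-Schwarz bounds the derivative. *)
Lemma mean_value_bound (R : realType) n (h : 'cV[R]_n -> R) p (d H : R) :
  (forall q, enorm (q - p) < d ->
     differentiable h q /\ enorm (rgrad h q) <= H) ->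
  forall q q', enorm (q - p) < d -> enorm (q' - p) < d ->
    `|h q - h q'| <= H * enorm (q - q').
Proof.
move=> hP q q' qp q'p.
set w := q - q'.
have seg (t : R) : 0 <= t <= 1 -> enorm (q' + t *: w - p) < d.
  move=> /andP[t0 t1].
  have -> : q' + t *: w - p = t *: (q - p) + (1 - t) *: (q' - p).
    by apply/matrixP => i j; rewrite /w !mxE; ring.
  rewrite (le_lt_trans (enormD _ _)) // !enormZ !ger0_norm ?subr_ge0 //.
  set a := enorm (q - p) in qp *; set b := enorm (q' - p) in q'p *.
  have ab : Num.max a b < d by rewrite gt_max qp.
  apply: le_lt_trans ab.
  have : a <= Num.max a b by rewrite le_max lexx.
  have : b <= Num.max a b by rewrite le_max lexx orbT.
  nra.
pose phi t := h (q' + t *: w).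
have dphi (t : R) : 0 <= t <= 1 -> is_derive t 1 phi (dot (rgrad h (q' + t *: w)) w).
  move=> /seg/hP[dh _].
  (* The difference quotients of [phi] at [t] and of [h] in direction [w] are the same function. *)
  have E : (fun s : R => s^-1 *: ((phi \o shift t) (s *: 1) - phi t)) =
           (fun s : R => s^-1 *: ((h \o shift (q' + t *: w)) (s *: w) - h (q' + t *: w))).
    apply/funext => s /=; congr (_ *: (h _ - _)).
    by rewrite scalerDl /= [s *: 1]mulr1 addrCA.
  have : derivable h (q' + t *: w) w by exact: diff_derivable.
  have : 'D_w h (q' + t *: w) = dot (rgrad h (q' + t *: w)) w.
    by rewrite deriveE // dot_diff.
  rewrite /derivable /derive -E => <- ?; exact: DeriveDef.
have phic : {within `[0, 1], continuous phi}.
  apply: derivable_within_continuous => t; rewrite in_itv /= => /dphi dt.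
  exact: ex_derive.
have [t|c] := MVT (df := fun t => dot (rgrad h (q' + t *: w)) w)
  (@ltr01 R) _ phic.
  by rewrite in_itv /= => /andP[/ltW t0 /ltW t1]; apply: dphi; rewrite t0.
rewrite in_itv /= => /andP[/ltW c0 /ltW c1].
rewrite subr0 mulr1 {1}/phi {1}/phi scale1r scale0r addr0 /w subrKC => ->.
have [_ gH] := hP _ (seg c ltac:(by rewrite c0 c1)).
have w0 := enorm_ge0 w.
apply: (@le_trans _ _ (enorm (rgrad h (q' + c *: w)) * enorm w)).
  by rewrite ler_norml cauchy_schwarz_lower cauchy_schwarz.
by rewrite ler_wpM2r.
Qed.

Lemma rgrad_coord (R : realType) n (h : 'cV[R]_n -> R) p i :
  rgrad (fun q => rgrad h q i 0) p = (row i (hessian h p))^T.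
Proof. by apply/matrixP => j k; rewrite !mxE. Qed.

(** Continuity bounds the Hessian near [p] by its norm at [p] plus 1; its rows are the gradients of
    the coordinates of [rgrad h], so the mean value bound applies to each coordinate. *)
Lemma rgrad_locally_lipschitz (R : realType) n (h : 'cV[R]_n -> R)
    (D : set 'cV[R]_n) (p : 'cV[R]_n) :
  twice_cont_differentiable_on h D -> nbhs p D ->
  exists d L : R, [/\ 0 < d, 0 <= L & forall q q',
    enorm (q - p) < d -> enorm (q' - p) < d ->
    enorm (rgrad h q - rgrad h q') <= L * enorm (q - q')].
Proof.
move=> hC2 nD; have [d1 d10 d1P] := (nbhs_enormP p D).1 nD.
have [_ _ hc] := hC2 p (nbhs_singleton nD).
have : \forall q \near p, `|hessian h p - hessian h q| < 1.
  exact: ((cvgrPdist_lt _ _).1 hc).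
case/nbhs_enormP => d2 d20 d2P.
set H := n.+1%:R * (`|hessian h p| + 1).
have H0 : 0 <= H by rewrite mulr_ge0 // addr_ge0.
have hP i q : enorm (q - p) < Num.min d1 d2 ->
    differentiable (fun q => rgrad h q i 0) q /\
    enorm (rgrad (fun q => rgrad h q i 0) q) <= H.
  rewrite lt_min => /andP[/d1P/hC2[_ dg _] /d2P hq]; split.
    exact: differentiable_comp dg (differentiable_coord _ i 0).
  rewrite rgrad_coord; apply: enorm_le_coord => [|j]; first exact: addr_ge0.
  have -> : (row i (hessian h q))^T j 0 = hessian h q i j by rewrite mxE mxE.
  have entry (M : 'M[R]_n) : `|M i j| <= `|M|.
    rewrite [leRHS]/Num.norm /= mx_normrE; apply/bigmax_geP; right.
    by exists (i, j).
  apply: le_trans (entry _) _.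
  rewrite -[X in `|X|](subrKC (hessian h p)) (le_trans (ler_normD _ _)) //.
  by rewrite lerD2l distrC ltW.
exists (Num.min d1 d2), (n.+1%:R * H); split => [||q q' qp q'p].
- by rewrite lt_min d10.
- exact: mulr_ge0.
rewrite -mulrA; apply: enorm_le_coord => [|i].
  by rewrite mulr_ge0 ?enorm_ge0.
by have := mean_value_bound (hP i) qp q'p; rewrite !mxE.
Qed.

(** As [K] may fail to be convex, local constants cannot be chained along segments. Instead [K * K]
    is covered: near the diagonal the local constant works, and away from it the distance is bounded
    below, so a bound on the increment of [F] suffices. *)
Lemma lipschitz_on_compact (R : realType) n k (F : 'cV[R]_n -> 'cV[R]_k)
    (K : set 'cV[R]_n) :
  compact K ->
  (forall p, K p -> exists d L : R, [/\ 0 < d, 0 <= L & forall q q',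
    enorm (q - p) < d -> enorm (q' - p) < d ->
    enorm (F q - F q') <= L * enorm (q - q')]) ->
  exists2 L : R, 0 <= L & forall p q, K p -> K q ->
    enorm (F p - F q) <= L * enorm (p - q).
Proof.
move=> cK Kloc.
have : \forall L \near +oo, K `*` K `<=` (fun pq : 'cV[R]_n * 'cV[R]_n =>
    enorm (F pq.1 - F pq.2) <= L * enorm (pq.1 - pq.2)).
  apply: ((compact_near_coveringP _).1 (compact_setX cK cK)).
  move=> [p q] /= [Kp Kq].
  have [d1 [L1 [d10 L10 F1]]] := Kloc p Kp.
  have [pq|pq] := eqVneq p q.
    exists ([set pq | enorm (pq.1 - p) < d1 /\ enorm (pq.2 - p) < d1],
            [set L | L1 <= L]) => /=.
      split; last exact: (nbhs_pinfty_ge (num_real _)).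
      exists ([set p' | enorm (p' - p) < d1], [set p' | enorm (p' - p) < d1]) => //.
      by rewrite -pq; split; apply/nbhs_enormP; exists d1.
    move=> [[p' q'] L] /= [[p'd q'd] LL].
    by rewrite (le_trans (F1 _ _ p'd q'd)) // ler_wpM2r ?enorm_ge0.
  have [d2 [L2 [d20 L20 F2]]] := Kloc q Kq.
  have e0 : 0 < enorm (p - q).
    rewrite lt_def enorm_ge0 andbT; apply: contra_neq pq => /enorm_eq0.
    by move/eqP; rewrite subr_eq0 => /eqP.
  set e := enorm (p - q) in e0.
  have d10' : 0 < Num.min d1 (e / 4) by rewrite lt_min d10 divr_gt0.
  have d20' : 0 < Num.min d2 (e / 4) by rewrite lt_min d20 divr_gt0.
  (* [B] bounds the increment of [F] for pairs near [(p, q)], whose distance is at least [e / 2]. *)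
  set B := enorm (F p - F q) + L1 * d1 + L2 * d2.
  exists ([set pq | enorm (pq.1 - p) < Num.min d1 (e / 4) /\
                    enorm (pq.2 - q) < Num.min d2 (e / 4)],
          [set L | B / (e / 2) <= L]) => /=.
    split; last exact: (nbhs_pinfty_ge (num_real _)).
    exists ([set p' | enorm (p' - p) < Num.min d1 (e / 4)],
            [set p' | enorm (p' - q) < Num.min d2 (e / 4)]) => //.
    split; apply/nbhs_enormP.
      by exists (Num.min d1 (e / 4)).
    by exists (Num.min d2 (e / 4)).
  move=> [[p' q'] L] /= [[]]; rewrite !lt_min => /andP[p1 p2] /andP[q1 q2].
  rewrite ler_pdivrMr ?divr_gt0 // => BL.
  have eE : e / 2 <= enorm (p' - q').
    have := enorm_triangle p p' q; have := enorm_triangle p' q' q.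
    rewrite -/e (enorm_distC p p'); lra.
  have FB : enorm (F p' - F q') <= B.
    have := enorm_triangle (F p') (F p) (F q').
    have := enorm_triangle (F p) (F q) (F q').
    have := F1 p' p p1; rewrite subrr enorm0 => /(_ d10).
    have := F2 q q'; rewrite subrr enorm0 => /(_ d20 q1).
    rewrite (enorm_distC q q').
    have : L1 * enorm (p' - p) <= L1 * d1 by rewrite ler_wpM2l // ltW.
    have : L2 * enorm (q' - q) <= L2 * d2 by rewrite ler_wpM2l // ltW.
    rewrite /B; lra.
  have B0 : 0 <= B.
    by rewrite /B !addr_ge0 ?enorm_ge0 // mulr_ge0 // ltW.
  have L0 : 0 <= L by rewrite -(pmulr_lge0 _ (divr_gt0 e0 (ltr0n _ 2))) (le_trans B0).
  by rewrite (le_trans FB) // (le_trans BL) // ler_wpM2l.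
case=> M [_ MP]; exists (Num.max M 0 + 1).
  by rewrite addr_ge0 // le_max lexx orbT.
move=> p q Kp Kq; apply: (MP _ _ (p, q)) => //.
by rewrite ltr_pwDr // le_max lexx.
Qed.

(** A Lebesgue number argument: half of a radius valid at [p] is valid at all points within that
    half of [p]. *)
Lemma uniformly_near_compact (R : realType) n (K : set 'cV[R]_n)
    (P : set 'cV[R]_n) :
  compact K -> (forall p, K p -> nbhs p P) ->
  exists2 d : R, 0 < d & forall p q, K p -> enorm (q - p) <= d -> P q.
Proof.
move=> cK KP.
have : \forall d \near 0^'+, K `<=` (fun p => forall q, enorm (q - p) <= d -> P q).
  apply: ((compact_near_coveringP _).1 cK) => p /KP/nbhs_enormP[d d0 dP].
  have d2 : 0 < d / 2 by rewrite divr_gt0.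
  exists ([set p' | enorm (p' - p) < d / 2], [set d' | d' <= d / 2]) => /=.
    split; last exact: nbhs_right_le.
    by apply/nbhs_enormP; exists (d / 2).
  move=> [p' d'] /= [p'd d'd] q qd; apply: dP.
  have := enorm_triangle q p' p; lra.
move=> /filterI -/(_ _ (nbhs_right_gt 0)) /filter_ex[d [dP d0]].
by exists d => // p q Kp; exact: dP.
Qed.

(** * Lines inside the domain and finiteness of extended-real values *)

Lemma enorm_col_mx0 (R : realType) m l (v : 'cV[R]_l) :
  enorm (col_mx (0 : 'cV_m) v) = enorm v.
Proof.
by rewrite /enorm dot_col_mx col_mxKu col_mxKd -/(enorm _) -enorm_sqr enorm0
   expr0n add0r.
Qed.

Lemma near_direction (R : realType) n (p w : 'cV[R]_n) (P : set 'cV[R]_n) :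
  nbhs p P -> exists2 d : R, 0 < d & forall t, `|t| < d -> P (p + t *: w).
Proof.
move=> /nbhs_enormP[d d0 dP].
have w1 : 0 < enorm w + 1 by rewrite ltr_wpDl ?enorm_ge0.
exists (d / (enorm w + 1)) => [|t]; first exact: divr_gt0.
rewrite ltr_pdivlMr // => td; apply: dP.
rewrite addrC addKr enormZ; apply: le_lt_trans td.
by rewrite ler_wpM2l // lerDl.
Qed.

Lemma edom_open (R : realType) n (h : 'cV[R]_n -> \bar R) p :
  continuous h -> (h p < +oo)%E -> nbhs p (edom h).
Proof.
move=> hc hp; apply: (hc p (fun y => y < +oo)%E).
by apply: open_nbhs_nbhs; split => //; exact: open_ereal_lt_ereal.
Qed.

(** Turns a descent inequality into finiteness of the new iterate together with an inequality
    between reals. *)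
Lemma fine_le_sum (R : realType) (a b : \bar R) (s t r : R) :
  (0 <= a)%E -> (0 <= b)%E -> (a + b + s%:E + t%:E <= r%:E)%E ->
  [/\ (a < +oo)%E, (b < +oo)%E & fine a + fine b + s + t <= r].
Proof.
by case: a b => [a| |] [b| |] //= _ _; rewrite ?ltry -?EFinD ?lee_fin.
Qed.

Lemma ge0_fineE (R : realType) (a : \bar R) :
  (0 <= a)%E -> (a < +oo)%E -> a = (fine a)%:E.
Proof. by case: a. Qed.

Lemma le_fin_lt_pinfty (R : realType) (b : \bar R) (s : R) :
  (b <= s%:E)%E -> (b < +oo)%E.
Proof. by move=> bs; exact: le_lt_trans bs (ltry _). Qed.

Lemma ge0_le_fin (R : realType) (b : \bar R) (s : R) :
  (0 <= b)%E -> (b < +oo)%E -> fine b <= s -> (b <= s%:E)%E.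
Proof. by move=> b0 boo bs; rewrite (ge0_fineE b0 boo) lee_fin. Qed.

(** * Descent and optimality conditions of a single x-, y- or z-step *)

Section steps.
Variables (R : realType) (n m l : nat) (f : 'cV[R]_n -> \bar R)
  (g : 'cV[R]_(m + l) -> \bar R) (A : 'M[R]_(m, n)) (Z : set 'cV[R]_l).
Hypotheses (f_ge0 : forall x, (0 <= f x)%E) (g_ge0 : forall p, (0 <= g p)%E).
Hypotheses (f_cont : continuous f) (g_cont : continuous g).
Hypothesis f_diff : differentiable_on (fine \o f) (edom f).
Hypothesis g_C2 : twice_cont_differentiable_on (fine \o g) (edom g).
Variables (beta betax betay : R).

Definition penalty (lam : 'cV[R]_m) (u : 'cV[R]_m) : R :=
  beta / 2 * enorm u ^+ 2 + dot lam u.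

Definition rlagrangian x y z lam : R :=
  fine (f x) + fine (g (col_mx y z)) + penalty lam (A *m x - y).

Lemma lagrangianE x y z lam : (f x < +oo)%E -> (g (col_mx y z) < +oo)%E ->
  lagrangian f g A beta x y z lam = (rlagrangian x y z lam)%:E.
Proof.
by move=> fx gyz; rewrite /lagrangian (ge0_fineE (f_ge0 x) fx)
  (ge0_fineE (g_ge0 _) gyz) -!EFinD.
Qed.

(** With [sqr_enorm_line], supplies the coefficients [a] and [b] required by [derive_at_min]. *)
Lemma penalty_line lam u w t :
  penalty lam (u + t *: w) = penalty lam u +
    (t * dot (beta *: u + lam) w + t ^+ 2 * (beta / 2 * enorm w ^+ 2)).
Proof.
rewrite /penalty !enorm_sqr !(dotDl, dotDr, dotZl, dotZr) (dotC w u); by field.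
Qed.

Lemma sqr_enorm_line k (u w : 'cV[R]_k) (t : R) :
  enorm (u + t *: w) ^+ 2 =
    enorm u ^+ 2 + (t * (2 * dot u w) + t ^+ 2 * enorm w ^+ 2).
Proof. rewrite !enorm_sqr !(dotDl, dotDr, dotZl, dotZr) (dotC w u); ring. Qed.

Lemma x_step_descent xk x y z lam :
  (f xk < +oo)%E -> (g (col_mx y z) < +oo)%E ->
  (x_objective f g A beta betax xk y z lam x
    <= x_objective f g A beta betax xk y z lam xk)%E ->
  (f x < +oo)%E /\ rlagrangian x y z lam + betax / 2 * enorm (x - xk) ^+ 2
    <= rlagrangian xk y z lam.
Proof.
move=> fxk gyz; rewrite /x_objective (lagrangianE _ fxk gyz) -EFinD.
rewrite subrr enorm0 expr0n mulr0 addr0 /lagrangian.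
by case/fine_le_sum.
Qed.

Lemma x_step_stationary xk x y z lam :
  (f x < +oo)%E -> (g (col_mx y z) < +oo)%E ->
  (\forall x' \near x, (x_objective f g A beta betax xk y z lam x
    <= x_objective f g A beta betax xk y z lam x')%E) ->
  grad f x = - (A^T *m (beta *: (A *m x - y) + lam) + betax *: (x - xk)).
Proof.
move=> fx gyz xmin; apply: dot_inj => w; rewrite dotNl dotDl dot_tr dotZl.
apply: (@derive_at_min _ _ _ _ _ _
  (beta / 2 * enorm (A *m w) ^+ 2 + betax / 2 * enorm w ^+ 2)).
  exact: f_diff.
have [d d0 dP] := near_direction w (filterI xmin (edom_open f_cont fx)).
exists d => // t td; have [xt ft] := dP t td.
move: xt; rewrite /x_objective !lagrangianE // -!EFinD lee_fin /rlagrangian.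
rewrite mulmxDr -scalemxAr (addrAC (A *m x)) penalty_line (addrAC x) sqr_enorm_line /=.
lra.
Qed.

Lemma y_step_descent x yk y z lam :
  (f x < +oo)%E -> (g (col_mx yk z) < +oo)%E ->
  (y_objective f g A beta betay x yk z lam y
    <= y_objective f g A beta betay x yk z lam yk)%E ->
  (g (col_mx y z) < +oo)%E /\
  rlagrangian x y z lam + betay / 2 * enorm (y - yk) ^+ 2
    <= rlagrangian x yk z lam.
Proof.
move=> fx gyz; rewrite /y_objective (lagrangianE _ fx gyz) -EFinD.
rewrite subrr enorm0 expr0n mulr0 addr0 /lagrangian.
by case/fine_le_sum.
Qed.

(** Moving along [col_mx w 0] isolates the [y]-part of the gradient of [g], while the residual
    [A *m x - y] moves along [- w]. *)
Lemma y_step_stationary x yk y z lam :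
  (f x < +oo)%E -> (g (col_mx y z) < +oo)%E ->
  (forall y', (y_objective f g A beta betay x yk z lam y
    <= y_objective f g A beta betay x yk z lam y')%E) ->
  grad_y g y z = lam + beta *: (A *m x - y) - betay *: (y - yk).
Proof.
move=> fx gyz ymin; apply: dot_inj => w.
have -> : dot (grad_y g y z) w = dot (grad g (col_mx y z)) (col_mx w 0).
  by rewrite dot_col_mx dot0r addr0.
have -> : dot (lam + beta *: (A *m x - y) - betay *: (y - yk)) w =
    - (dot (beta *: (A *m x - y) + lam) (- w) + betay * dot (y - yk) w).
  by rewrite !(dotDl, dotNl, dotZl, dotNr); ring.
apply: (@derive_at_min _ _ _ _ _ _
  (beta / 2 * enorm (- w) ^+ 2 + betay / 2 * enorm w ^+ 2)).
  by have [] := g_C2 gyz.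
have [d d0 dP] := near_direction (col_mx w 0) (edom_open g_cont gyz).
exists d => // t td; have := dP t td; rewrite /edom /=.
rewrite scale_col_mx scaler0 add_col_mx addr0 => gt.
have := ymin (y + t *: w).
rewrite /y_objective !lagrangianE // -!EFinD lee_fin /rlagrangian.
have -> : A *m x - (y + t *: w) = A *m x - y + t *: (- w).
  by rewrite opprD addrA scalerN.
rewrite penalty_line (addrAC y) sqr_enorm_line /=.
lra.
Qed.

(** Only [g] depends on [z] in the Lagrangian; the other terms are finite and cancel. *)
Lemma z_step_min x y z lam z' :
  (f x < +oo)%E ->
  (lagrangian f g A beta x y z lam <= lagrangian f g A beta x y z' lam)%E ->
  (g (col_mx y z) <= g (col_mx y z'))%E.
Proof.
move=> fx; rewrite /lagrangian (ge0_fineE (f_ge0 x) fx).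
by rewrite leeD2rE // leeD2lE.
Qed.

(** Minimality over [Z] and the first-order expansion of [g] in [z] give the inequality that defines
    a regular normal. *)
Lemma z_step_normal y z :
  (g (col_mx y z) < +oo)%E -> Z z ->
  (forall z', Z z' -> (g (col_mx y z) <= g (col_mx y z'))%E) ->
  limiting_normal_cone Z z (- grad_z g y z).
Proof.
move=> gyz Zz zmin; apply: regular_normal_min => // e e0.
have [dg _ _] := g_C2 gyz.
have [d d0 dP] := frechet dg e0.
have [d' d'0 d'P] := (nbhs_enormP _ _).1 (edom_open g_cont gyz).
exists (Num.min d d'); first by rewrite lt_min d0.
move=> z' Zz'; rewrite lt_min => /andP[zd zd'].
have E : col_mx y z' - col_mx y z = col_mx 0 (z' - z).
  by rewrite opp_col_mx add_col_mx subrr.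
have En : enorm (col_mx y z' - col_mx y z) = enorm (z' - z).
  by rewrite E enorm_col_mx0.
have := dP (col_mx y z'); rewrite En => /(_ zd).
have := d'P (col_mx y z'); rewrite En => /(_ zd') g'.
rewrite E dot_col_mx dot0r add0r.
have := zmin _ Zz'; rewrite (ge0_fineE (g_ge0 _) gyz) (ge0_fineE (g_ge0 _) g').
rewrite lee_fin /= ler_norml -/(grad_z g y z) => gz /andP[_].
rewrite -/(grad g _) -/(grad_z g y z); lra.
Qed.

End steps.

(** * Constants valid on a compact sublevel set *)

Lemma compact_sublevel (R : realType) n (h : 'cV[R]_n -> \bar R) (r M : R) :
  continuous h -> compact [set p | (h p <= M%:E)%E /\ enorm p <= r].
Proof.
move=> hc; apply: (compact_enorm_le (D := [set p | (h p <= M%:E)%E])).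
apply: (preimage_closed (f := h) (D := [set t | (t <= M%:E)%E])).
  by move=> p _; exact: hc.
exact: closed_ereal_ge_ereal.
Qed.

Lemma rgrad_lipschitz_sublevel (R : realType) n (h : 'cV[R]_n -> \bar R)
    (r M : R) :
  continuous h -> twice_cont_differentiable_on (fine \o h) (edom h) ->
  exists2 L : R, 0 <= L & forall p q,
    (h p <= M%:E)%E -> enorm p <= r -> (h q <= M%:E)%E -> enorm q <= r ->
    enorm (grad h p - grad h q) <= L * enorm (p - q).
Proof.
move=> hc hC2; have cK := compact_sublevel (r := r) (M := M) hc.
have [|L L0 LP] := lipschitz_on_compact (F := grad h) cK.
  move=> p [/= hp _]; apply: rgrad_locally_lipschitz hC2 _.
  by apply: edom_open => //; exact: le_lt_trans hp (ltry _).
by exists L => // p q *; apply: LP.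
Qed.

(** None of these constants depends on [beta], [betax] or [betay]. [r0] bounds [(x, z)] by
    coercivity; [a * r0 + 2] then bounds the next [y], with one unit for the gap and one for the
    y-step; [r] is the radius for [(y, z)]; moving by [d] raises [g] to at most [M + 1]. [G] and
    [Lg] bound the gradient of [g] and its variation, [Lz] that of the map [z(y)]. *)
Record bc_bounds (R : realType) (n m l : nat)
    (f : 'cV[R]_n -> \bar R) (g : 'cV[R]_(m + l) -> \bar R)
    (A : 'M[R]_(m, n)) (Z : set 'cV[R]_l) (M a a' r0 r d G Lg Lz : R) : Prop :=
  BcBounds {
  bb_ge0 : [/\ 0 <= a, 0 <= a', 0 <= G, 0 <= Lg & 0 <= Lz];
  bb_mul : forall u, enorm (A *m u) <= a * enorm u;
  bb_tr : forall u, enorm (A^T *m u) <= a' * enorm u;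
  bb_level : forall x z, (f x + g (col_mx (A *m x)%R z) <= (2 * M + 1)%:E)%E ->
    enorm x <= r0 /\ enorm z <= r0;
  bb_radius : a * r0 + 2 + r0 <= r;
  bb_zmap : forall y z, (g (col_mx y z) <= M%:E)%E -> Z z ->
    enorm y <= a * r0 + 2 -> enorm z <= r0 ->
    (exists! w, zargmin g Z y w) /\ Sset g Z r M y (zmap g Z y);
  bb_margin : 0 < d <= 1;
  bb_near : forall p q, (g p <= M%:E)%E -> enorm p <= r -> enorm (q - p) <= d ->
    (g q <= (M + 1)%:E)%E;
  bb_grad : forall p, (g p <= (M + 1)%:E)%E -> enorm p <= r + 1 ->
    enorm (grad g p) <= G;
  bb_lip : forall p q, (g p <= (M + 1)%:E)%E -> enorm p <= r + 1 ->
    (g q <= (M + 1)%:E)%E -> enorm q <= r + 1 ->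
    enorm (grad g p - grad g q) <= Lg * enorm (p - q);
  bb_zlip : forall y1 y2, Sset g Z r M y1 (zmap g Z y1) ->
    Sset g Z r M y2 (zmap g Z y2) ->
    enorm (zmap g Z y1 - zmap g Z y2) <= Lz * enorm (y1 - y2)
}.

Lemma bc_bounds_exist (R : realType) (n m l : nat)
    (f : 'cV[R]_n -> \bar R) (g : 'cV[R]_(m + l) -> \bar R)
    (A : 'M[R]_(m, n)) (Z : set 'cV[R]_l) (x0 : 'cV[R]_n) (z0 : 'cV[R]_l)
    (M : R) :
  bc_assumption f g A Z x0 z0 -> 1 <= M ->
  exists a a' r0 r d G Lg Lz, bc_bounds f g A Z M a a' r0 r d G Lg Lz.
Proof.
move=> H M1.
have M0 : 0 < M by lra.
have [a a0 aP] := enorm_mulmx A.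
have [a' a'0 a'P] := enorm_mulmx A^T.
have [rho rhoP] := bc_coercive H (2 * M + 1).
pose r0 := Num.max rho 0.
have r00 : 0 <= r0 by rewrite le_max lexx orbT.
have r1_gt0 : 0 < a * r0 + 2 + r0.
  by rewrite -addrA ltr_wpDl ?mulr_ge0 //; lra.
have [r2 r2P] := bc_zmap H r1_gt0 M0.
(* [Sset] grows with its radius, so one [r] can cover both the points fed to the assumption on
   [z(y)] and the radius it returns. *)
pose r := Num.max r2 (a * r0 + 2 + r0).
have rr1 : a * r0 + 2 + r0 <= r by rewrite le_max lexx orbT.
have r_gt0 : 0 < r by exact: lt_le_trans rr1.
have near_sublevel p : (g p <= M%:E)%E ->
    nbhs p [set q | (g q <= (M + 1)%:E)%E].
  move=> gp; have := @bc_g_cont _ _ _ _ _ _ _ _ _ _ H p (fun t => (t < (M + 1)%:E)%E).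
  have : nbhs (g p) (fun t => t < (M + 1)%:E)%E.
    apply: open_nbhs_nbhs; split; first exact: open_ereal_lt_ereal.
    by apply: le_lt_trans gp _; rewrite lte_fin ltrDl.
  move=> N /(_ N) F; have : nbhs p [set q | (g q < (M + 1)%:E)%E] by exact: F.
  by apply: filterS => q /=; exact: ltW.
have [d d0 dP] := uniformly_near_compact
  (compact_sublevel (r := r) (M := M) (bc_g_cont H))
  (fun p Kp => near_sublevel p Kp.1).
have [Lg Lg0 LgP] := rgrad_lipschitz_sublevel (r + 1) (M + 1) (bc_g_cont H)
  (bc_g_C2 H).
have [Lz LzP] := bc_zmap_lip H r_gt0 M0.
have [G G0 GP] : exists2 G : R, 0 <= G & forall p, (g p <= (M + 1)%:E)%E ->
    enorm p <= r + 1 -> enorm (grad g p) <= G.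
  (* A Lipschitz map on a bounded set is bounded through its value at one reference point; if the
     set is empty, 0 will do. *)
  have [[q [gq qr]]|noq] :=
    pselect (exists q, (g q <= (M + 1)%:E)%E /\ enorm q <= r + 1).
    exists (enorm (grad g q) + Lg * (2 * (r + 1))) => [|p gp pr].
      by rewrite addr_ge0 ?enorm_ge0 ?mulr_ge0 //; lra.
    apply: le_trans (enorm_lerD _ (grad g q)) _; rewrite lerD2l.
    apply: le_trans (LgP _ _ gp pr gq qr) _; rewrite ler_wpM2l //.
    by apply: le_trans (enormD _ _) _; rewrite enormN; lra.
  by exists 0 => // p gp pr; case: noq; exists p.
(* The margin is cut to 1 to fit the radius [r + 1]; the absolute value makes the Lipschitz constant
   of [z(y)] nonnegative. *)
exists a, a', r0, r, (Num.min d 1), G, Lg, `|Lz|.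
have SsetS y z : Sset g Z r2 M y z -> Sset g Z r M y z.
  by case=> gyz yz Zz; split => //; rewrite (le_trans yz) // le_max lexx.
split => //.
- move=> x z xz; have : enorm (col_mx x z) <= r0.
    rewrite le_max leNgt; apply/orP; left; apply/negP => /rhoP.
    by rewrite col_mxKu col_mxKd ltNge xz.
  by move=> xzr; split; [exact: le_trans (enorm_col_mxu _ _) xzr
                        |exact: le_trans (enorm_col_mxd _ _) xzr].
- move=> y z gyz Zz yr zr; have [|ex Sz] := r2P y z.
    split => //; apply: le_trans (enorm_col_mx_le _ _) _; exact: lerD.
  by split => //; exact: SsetS.
- by rewrite lt_min d0 ltr01 ge_min lexx orbT.
- by move=> p q gp pr; rewrite le_min => /andP[qp _]; exact: (dP p).
move=> y1 y2 S1 S2; apply: le_trans (LzP _ _ S1 S2) _.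
by rewrite ler_wpM2r ?enorm_ge0 // ler_norm.
Qed.

Lemma zmap_argmin (R : realType) (m l : nat) (g : 'cV[R]_(m + l) -> \bar R)
    (Z : set 'cV[R]_l) y :
  (exists! w, zargmin g Z y w) ->
  zargmin g Z y (zmap g Z y) /\
  forall w, zargmin g Z y w -> zmap g Z y = w.
Proof.
move=> [w [yw wu]].
have zw : zargmin g Z y (zmap g Z y) by apply: getPex; exists w.
by split => // w' yw'; rewrite -(wu _ yw') (wu _ zw).
Qed.

Lemma zargminP (R : realType) (m l : nat) (g : 'cV[R]_(m + l) -> \bar R)
    (Z : set 'cV[R]_l) y z :
  (forall p, (0 <= g p)%E) -> Z z ->
  zargmin g Z y z <-> forall z', Z z' -> (g (col_mx y z) <= g (col_mx y z'))%E.
Proof.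
move=> g0 Zz; have indicZ w : Z w -> indic_fun R Z w = 0%E.
  by move=> Zw; rewrite /indic_fun asboolT.
split=> [[_ zmin] z' Zz'|zmin].
  by have := zmin z' I; rewrite !indicZ // !adde0.
split => // z' _; rewrite indicZ // adde0.
have [Zz'|Zz'] := pselect (Z z'); first by rewrite indicZ // adde0 zmin.
rewrite /indic_fun asboolF // addey ?leey //.
by rewrite gt_eqF // (lt_le_trans _ (g0 _)) // ltNyr.
Qed.

(** * The invariant of the iteration and the descent of the merit function *)

Section iteration.
Variables (R : realType) (n m l : nat) (f : 'cV[R]_n -> \bar R)
  (g : 'cV[R]_(m + l) -> \bar R) (A : 'M[R]_(m, n)) (Z : set 'cV[R]_l)
  (x0 : 'cV[R]_n) (z0 : 'cV[R]_l) (M a a' r0 r d G Lg Lz : R).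
Hypothesis H : bc_assumption f g A Z x0 z0.
Hypothesis bounds : bc_bounds f g A Z M a a' r0 r d G Lg Lz.
Variables (beta betax betay : R).
Variables (x : nat -> 'cV[R]_n) (y : nat -> 'cV[R]_m)
  (z : nat -> 'cV[R]_l) (lam : nat -> 'cV[R]_m).
Hypothesis admm : bc_admm f g A Z x0 beta betax betay x y z lam.

(** [Lam] bounds the multipliers, [K] is the factor in the dual increment, and [c] comes from
    [(s + t)^2 <= 2 (s^2 + t^2)]. *)
Let Lam := G + betay.
Let K := Lg * (1 + Lz) + betay.
Let c := 2 * K ^+ 2.

(** [betay_ge] keeps y-steps of length at most 1, [beta_Lam] bounds the penalty below, [beta_gap]
    keeps the gap within [d], and [beta_desc] lets the decrease in [y] absorb the dual increase. *)
Hypotheses (M_ge1 : 1 <= M) (betax_gt0 : 0 < betax) (betay_ge : 2 * M <= betay).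
Hypotheses (beta_gt0 : 0 < beta) (beta_Lam : Lam ^+ 2 <= beta)
  (beta_gap : 2 * Lam <= d * beta) (beta_desc : 8 * c <= beta * betay).

Let rL := rlagrangian f g A beta.

(* At k = 0 the truncated k.-1 makes the previous iterate equal to the current
   one, which matches lam 0 = grad_y g (y 0) (z 0). *)
Definition merit k : R :=
  rL (x k) (y k) (z k) (lam k) + c / beta * enorm (y k - y k.-1) ^+ 2.

(** Besides [(y k, z k)], the point [(y k, z k.-1)] is tracked, since y-optimality expresses the
    multiplier there. The merit bound [M - 1] leaves room for a penalty as low as [- 1 / 2]. *)
Record admm_inv k : Prop := AdmmInv {
  inv_f : (f (x k) <= M%:E)%E;
  inv_S : Sset g Z r M (y k) (z k);
  inv_z : z k = zmap g Z (y k);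
  inv_F : (f (x k) + g (col_mx (A *m x k)%R (z k)) <= (2 * M + 1)%:E)%E;
  inv_gap : enorm (A *m x k - y k) <= d;
  inv_dy : enorm (y k - y k.-1) <= 1;
  inv_lam : lam k = grad_y g (y k) (z k.-1) + betay *: (y k - y k.-1);
  inv_yz : (g (col_mx (y k) (z k.-1)) <= M%:E)%E;
  inv_yzr : enorm (col_mx (y k) (z k.-1)) <= r;
  inv_prevS : Sset g Z r M (y k.-1) (z k.-1);
  inv_prevz : z k.-1 = zmap g Z (y k.-1);
  inv_merit : merit k <= M - 1
}.

Let f_ge0 := bc_f_ge0 H.
Let g_ge0 := bc_g_ge0 H.
Let betay_gt0 : 0 < betay. Proof. by move: M_ge1 betay_ge; lra. Qed.
Let Lg_ge0 : 0 <= Lg. Proof. by case: (bb_ge0 bounds). Qed.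
Let Lz_ge0 : 0 <= Lz. Proof. by case: (bb_ge0 bounds). Qed.
Let K_ge0 : 0 <= K.
Proof. by rewrite /K addr_ge0 ?mulr_ge0 ?addr_ge0 // ltW. Qed.
Let c_ge0 : 0 <= c. Proof. by rewrite mulr_ge0 // sqr_ge0. Qed.
Let Lam_ge0 : 0 <= Lam.
Proof. by rewrite /Lam addr_ge0 // ?(ltW betay_gt0) //; case: (bb_ge0 bounds). Qed.

Lemma enorm_multiplier_le y' z' y0 : (g (col_mx y' z') <= (M + 1)%:E)%E ->
  enorm (col_mx y' z') <= r + 1 -> enorm (y' - y0) <= 1 ->
  enorm (grad_y g y' z' + betay *: (y' - y0)) <= Lam.
Proof.
move=> gyz yzr yy; apply: le_trans (enormD _ _) _; apply: lerD.
  exact: le_trans (enorm_usubmx _) (bb_grad bounds gyz yzr).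
by rewrite enormZ gtr0_norm // ler_piMr // ltW.
Qed.

Lemma inv_multiplier k : admm_inv k -> enorm (lam k) <= Lam.
Proof.
move=> I; rewrite (inv_lam I); apply: enorm_multiplier_le (inv_dy I).
  by apply: le_trans (inv_yz I) _; rewrite lee_fin lerDl.
by apply: le_trans (inv_yzr I) _; rewrite lerDl.
Qed.

(** By Cauchy-Schwarz and [Lam ^+ 2 <= beta], the penalty is at least [t^2 / 2 - t] with
    [t = Lam * enorm u]; completing the square gives the bound. *)
Lemma penalty_lower (v u : 'cV[R]_m) :
  enorm v <= Lam -> - (1 / 2) <= penalty beta v u.
Proof.
move=> vL; rewrite /penalty.
have u0 := enorm_ge0 u; have := cauchy_schwarz_lower v u.
have : enorm v * enorm u <= Lam * enorm u by rewrite ler_wpM2r.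
have : Lam ^+ 2 * enorm u ^+ 2 <= beta * enorm u ^+ 2.
  by rewrite ler_wpM2r ?sqr_ge0.
have := sqr_ge0 (Lam * enorm u - 1); nra.
Qed.

Lemma merit_lower k : admm_inv k -> - (1 / 2) <= merit k.
Proof.
move=> I; have := penalty_lower (A *m x k - y k) (inv_multiplier I).
have : 0 <= c / beta * enorm (y k - y k.-1) ^+ 2.
  by rewrite mulr_ge0 ?sqr_ge0 // divr_ge0 // ltW.
have := fine_ge0 (f_ge0 (x k)); have := fine_ge0 (g_ge0 (col_mx (y k) (z k))).
rewrite /merit /rL /rlagrangian; lra.
Qed.

Lemma rL_le_merit k : rL (x k) (y k) (z k) (lam k) <= merit k.
Proof. by rewrite lerDl mulr_ge0 ?sqr_ge0 // divr_ge0 // ltW. Qed.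

(** Descent keeps the Lagrangian at most [M - 1]; as [g] is nonnegative and the penalty at least
    [- 1 / 2], this bounds [f]. *)
Lemma inv_x_step k : admm_inv k ->
  [/\ (f (x k.+1) < +oo)%E, fine (f (x k.+1)) <= M &
      rL (x k.+1) (y k) (z k) (lam k) + betax / 2 * enorm (x k.+1 - x k) ^+ 2
        <= rL (x k) (y k) (z k) (lam k)].
Proof.
move=> I; have [gyz _ _] := inv_S I.
have [fx' desc] := x_step_descent f_ge0 g_ge0
  (le_fin_lt_pinfty (inv_f I)) (le_fin_lt_pinfty gyz)
  (bc_x_descent admm k).
split => //; have := le_trans (rL_le_merit k) (inv_merit I).
have := penalty_lower (A *m x k.+1 - y k) (inv_multiplier I).
have : 0 <= betax / 2 * enorm (x k.+1 - x k) ^+ 2.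
  by rewrite mulr_ge0 ?sqr_ge0 // divr_ge0 // ltW.
have := fine_ge0 (g_ge0 (col_mx (y k) (z k))).
move: desc; rewrite /rL /rlagrangian; lra.
Qed.

Lemma inv_y_step k : admm_inv k ->
  [/\ (g (col_mx (y k.+1) (z k)) <= M%:E)%E, enorm (y k.+1 - y k) <= 1 &
      rL (x k.+1) (y k.+1) (z k) (lam k)
        + betay / 2 * enorm (y k.+1 - y k) ^+ 2
        <= rL (x k.+1) (y k) (z k) (lam k)].
Proof.
move=> I; have [gyz _ _] := inv_S I; have [fx' _ xdesc] := inv_x_step I.
have [_ ymin] := bc_y_step admm k.
have [gy' desc] := y_step_descent f_ge0 g_ge0 fx'
  (le_fin_lt_pinfty gyz) (ymin (y k) Logic.I).
have rLM := le_trans (rL_le_merit k) (inv_merit I).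
have pen := penalty_lower (A *m x k.+1 - y k.+1) (inv_multiplier I).
have dx0 : 0 <= betax / 2 * enorm (x k.+1 - x k) ^+ 2.
  by rewrite mulr_ge0 ?sqr_ge0 // divr_ge0 // ltW.
have dy0 : 0 <= betay / 2 * enorm (y k.+1 - y k) ^+ 2.
  by rewrite mulr_ge0 ?sqr_ge0 // divr_ge0 // ltW.
have fx0 := fine_ge0 (f_ge0 (x k.+1)).
have gy0 := fine_ge0 (g_ge0 (col_mx (y k.+1) (z k))).
move: (desc) xdesc; rewrite {1}/rlagrangian /rL => desc' xdesc.
split => //.
  by apply: ge0_le_fin => //; rewrite /rL in rLM; lra.
(* The proximal term is at most [M - 1 / 2], hence at most [betay / 2]. *)
have : betay / 2 * enorm (y k.+1 - y k) ^+ 2 <= betay / 2 * 1.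
  by rewrite /rL in rLM; move: betay_ge; lra.
rewrite ler_pM2l ?divr_gt0 // -[X in _ <= X](expr1n _ 2).
by rewrite ler_sqr ?nnegrE ?enorm_ge0.
Qed.

(** The pair [(y k.+1, z k)] is still within level [M] and the required radii, so the assumption on
    [z(y)] applies at [y k.+1] and identifies the z-step with [zmap]. *)
Lemma inv_z_step k : admm_inv k ->
  [/\ z k.+1 = zmap g Z (y k.+1), Sset g Z r M (y k.+1) (z k.+1),
      forall z', Z z' ->
        (g (col_mx (y k.+1) (z k.+1)) <= g (col_mx (y k.+1) z'))%E &
      enorm (col_mx (y k.+1) (z k)) <= r].
Proof.
move=> I; have [gyz yzr Zz] := inv_S I.
have [fx' _ _] := inv_x_step I; have [gy' dy _] := inv_y_step I.
have [xr zr] := bb_level bounds (inv_F I).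
have [a0 _ _ _ _] := bb_ge0 bounds; have [/andP[_ d1]] := bb_margin bounds.
have yr : enorm (y k.+1) <= a * r0 + 2.
  have := enorm_lerD (y k.+1) (y k); have := enorm_lerD (y k) (A *m x k).
  have := bb_mul bounds (x k); rewrite (enorm_distC (y k)).
  have : a * enorm (x k) <= a * r0 by rewrite ler_wpM2l.
  by have := inv_gap I; lra.
have [ex Sz'] := bb_zmap bounds gy' Zz yr zr.
have [Zz' zmin] := bc_z_step admm k.
have {}zmin z' (Zz'' : Z z') := z_step_min f_ge0 fx' (zmin z' Zz'').
have zE : z k.+1 = zmap g Z (y k.+1).
  by apply/esym/(zmap_argmin ex).2/zargminP.
split; rewrite ?zE //; last first.
  apply: le_trans (enorm_col_mx_le _ _) (le_trans _ (bb_radius bounds)).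
  exact: lerD.
by rewrite -zE.
Qed.

(** The dual update turns the term [lam k + beta *: (A *m x k.+1 - y k.+1)] of y-optimality into
    [lam k.+1]. *)
Lemma inv_lam_step k : admm_inv k ->
  lam k.+1 = grad_y g (y k.+1) (z k) + betay *: (y k.+1 - y k).
Proof.
move=> I; have [fx' _ _] := inv_x_step I; have [gy' _ _] := inv_y_step I.
have [_ ymin] := bc_y_step admm k.
rewrite (y_step_stationary f_ge0 g_ge0 (bc_g_cont H) (bc_g_C2 H) fx'
  (le_fin_lt_pinfty gy') (fun y' => ymin y' Logic.I)).
by rewrite subrK (bc_lam_step admm).
Qed.

Lemma level_widen p : (g p <= M%:E)%E -> (g p <= (M + 1)%:E)%E.
Proof. by move=> gp; apply: le_trans gp _; rewrite lee_fin lerDl. Qed.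

Lemma radius_widen k (u : 'cV[R]_k) : enorm u <= r -> enorm u <= r + 1.
Proof. by move=> ur; apply: le_trans ur _; rewrite lerDl. Qed.

Lemma inv_multiplier_step k : admm_inv k -> enorm (lam k.+1) <= Lam.
Proof.
move=> I; have [gy' dy _] := inv_y_step I; have [_ _ _ yr] := inv_z_step I.
rewrite (inv_lam_step I).
exact: enorm_multiplier_le (level_widen gy') (radius_widen yr) dy.
Qed.

Lemma grad_y_lip y1 z1 y2 z2 :
  (g (col_mx y1 z1) <= (M + 1)%:E)%E -> enorm (col_mx y1 z1) <= r + 1 ->
  (g (col_mx y2 z2) <= (M + 1)%:E)%E -> enorm (col_mx y2 z2) <= r + 1 ->
  enorm (grad_y g y1 z1 - grad_y g y2 z2)
    <= Lg * (enorm (y1 - y2) + enorm (z1 - z2)).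
Proof.
move=> g1 r1 g2 r2; rewrite /grad_y -linearB /=.
apply: le_trans (enorm_usubmx _) _.
apply: le_trans (bb_lip bounds g1 r1 g2 r2) _.
rewrite ler_wpM2l // opp_col_mx add_col_mx; exact: enorm_col_mx_le.
Qed.

(** Two consecutive multiplier formulas are subtracted. They involve [z k] and [z k.-1], whose
    distance is controlled by the previous y-step; hence the lagged term. *)
Lemma inv_dual_increment k : admm_inv k ->
  enorm (lam k.+1 - lam k)
    <= K * (enorm (y k.+1 - y k) + enorm (y k - y k.-1)).
Proof.
move=> I; have [gy' _ _] := inv_y_step I; have [_ _ _ yr] := inv_z_step I.
rewrite (inv_lam_step I) (inv_lam I) opprD addrACA -scalerBr.
apply: le_trans (enormD _ _) _; rewrite enormZ gtr0_norm //.
have : enorm (grad_y g (y k.+1) (z k) - grad_y g (y k) (z k.-1)) <=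
    Lg * (enorm (y k.+1 - y k) + enorm (z k - z k.-1)).
  apply: grad_y_lip (level_widen gy') (radius_widen yr) _ _.
    exact: level_widen (inv_yz I).
  exact: radius_widen (inv_yzr I).
have : enorm (z k - z k.-1) <= Lz * enorm (y k - y k.-1).
  have := inv_S I; have := inv_prevS I.
  by rewrite (inv_z I) (inv_prevz I) => S1 S2; exact: (bb_zlip bounds).
move=> /(ler_wpM2l Lg_ge0).
have := enormD (y k.+1 - y k) (- (y k - y k.-1)); rewrite enormN.
move=> /(ler_wpM2l (ltW betay_gt0)).
have : 0 <= Lg * Lz * enorm (y k.+1 - y k).
  by rewrite !mulr_ge0 ?enorm_ge0.
have : 0 <= Lg * enorm (y k - y k.-1) by rewrite mulr_ge0 ?enorm_ge0.
rewrite /K; lra.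
Qed.

Lemma gap_eq k : A *m x k.+1 - y k.+1 = beta^-1 *: (lam k.+1 - lam k).
Proof.
by rewrite (bc_lam_step admm) (addrC (lam k)) addrK scalerA mulVf ?scale1r // gt_eqF.
Qed.

Lemma inv_gap_step k : admm_inv k -> enorm (A *m x k.+1 - y k.+1) <= d.
Proof.
move=> I; rewrite gap_eq enormZ gtr0_norm ?invr_gt0 //.
rewrite ler_pdivrMl // mulrC; apply: le_trans beta_gap.
apply: le_trans (enormD _ _) _; rewrite enormN mulr_natl mulr2n.
exact: lerD (inv_multiplier_step I) (inv_multiplier I).
Qed.

(** The dual update adds [|lam k.+1 - lam k|^2 / beta], at most [c / beta * (s^2 + t^2)]. The lagged
    [t^2] is paid by [merit k]. The [s^2] term occurs twice, here and in [merit k.+1]; each costs at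
    most [betay / 8], leaving [betay / 4] of the proximal [betay / 2]. *)
Lemma inv_descent k : admm_inv k ->
  merit k.+1 + (betax / 2 * enorm (x k.+1 - x k) ^+ 2
    + betay / 4 * enorm (y k.+1 - y k) ^+ 2) <= merit k.
Proof.
move=> I; have [_ _ xdesc] := inv_x_step I; have [gy' _ ydesc] := inv_y_step I.
have [gyz _ Zz] := inv_S I; have [_ [gz' _ _] zmin _] := inv_z_step I.
have zdesc : fine (g (col_mx (y k.+1) (z k.+1))) <= fine (g (col_mx (y k.+1) (z k))).
  have gyz' := zmin _ Zz; apply: fine_le gyz'; rewrite ge0_fin_numE //.
    exact: le_fin_lt_pinfty gz'.
  exact: le_fin_lt_pinfty gy'.
have rise : penalty beta (lam k.+1) (A *m x k.+1 - y k.+1) =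
    penalty beta (lam k) (A *m x k.+1 - y k.+1)
      + beta^-1 * enorm (lam k.+1 - lam k) ^+ 2.
  rewrite /penalty -addrA; congr (_ + _).
  by rewrite enorm_sqr -dotZr -gap_eq -dotDl subrKC.
rewrite /merit /=.
set s := enorm (y k.+1 - y k) in xdesc ydesc *.
set t := enorm (y k - y k.-1).
have : beta^-1 * enorm (lam k.+1 - lam k) ^+ 2 <= c / beta * (s ^+ 2 + t ^+ 2).
  rewrite [c / beta]mulrC -mulrA ler_pM2l ?invr_gt0 //.
  apply: (@le_trans _ _ ((K * (s + t)) ^+ 2)).
    rewrite ler_sqr ?nnegrE ?enorm_ge0 //; first exact: inv_dual_increment.
    by rewrite mulr_ge0 // addr_ge0 // enorm_ge0.
  rewrite /c exprMn; have := sqr_ge0 K; have := sqr_ge0 (s - t); nra.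
have : c / beta * s ^+ 2 <= betay / 8 * s ^+ 2.
  rewrite ler_wpM2r ?sqr_ge0 // ler_pdivrMr // mulrAC ler_pdivlMr //.
  by rewrite mulrC (mulrC betay).
move: xdesc ydesc; rewrite /rL /rlagrangian rise; lra.
Qed.

Lemma near_level k : admm_inv k ->
  (g (col_mx (A *m x k.+1) (z k.+1)) <= (M + 1)%:E)%E /\
  enorm (col_mx (A *m x k.+1) (z k.+1)) <= r + 1.
Proof.
move=> I; have [_ [gz' zr _] _ _] := inv_z_step I.
have E : col_mx (A *m x k.+1) (z k.+1) - col_mx (y k.+1) (z k.+1) =
    col_mx (A *m x k.+1 - y k.+1) 0.
  by rewrite opp_col_mx add_col_mx subrr.
have gap : enorm (col_mx (A *m x k.+1) (z k.+1) - col_mx (y k.+1) (z k.+1)) <= d.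
  rewrite E; apply: le_trans (enorm_col_mx_le _ _) _.
  by rewrite enorm0 addr0; exact: inv_gap_step.
split; first exact: (bb_near bounds gz' zr gap).
have [/andP[_ d1]] := bb_margin bounds.
apply: le_trans (enorm_lerD _ (col_mx (y k.+1) (z k.+1))) _.
exact: lerD zr (le_trans gap d1).
Qed.

Lemma inv_succ k : admm_inv k -> admm_inv k.+1.
Proof.
move=> I; have [fx' fxM _] := inv_x_step I; have [gy' dy _] := inv_y_step I.
have [zE Sz' _ yr] := inv_z_step I.
have fxM' : (f (x k.+1) <= M%:E)%E by exact: ge0_le_fin.
split => //=.
(* The bounds [M] on [f] and [M + 1] on [g] at [A *m x k.+1] add up to the coercivity level. *)
- have [gM _] := near_level I; apply: le_trans (leeD fxM' gM) _.
  by rewrite -EFinD lee_fin; lra.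
- exact: inv_gap_step.
- exact: inv_lam_step.
- exact: inv_S I.
- exact: inv_z I.
apply: le_trans (inv_merit I); apply: le_trans (inv_descent I).
rewrite lerDl addr_ge0 // mulr_ge0 ?sqr_ge0 // divr_ge0 // ltW //.
Qed.

(** Initially the gap and the lagged difference vanish, so the merit is the objective value. *)
Lemma inv_0 : Z (zmap g Z (A *m x0)) ->
  (f x0 + g (col_mx (A *m x0)%R (zmap g Z (A *m x0)%R)) <= (M - 1)%:E)%E ->
  admm_inv 0.
Proof.
rewrite -(bc_y_init admm) -(bc_z_init admm) -(bc_x_init admm) => Zz.
have y0E : y 0%N = A *m x 0%N by rewrite (bc_y_init admm) (bc_x_init admm).
rewrite -(adde0 (f _ + _)%E) -(adde0 (f _ + _ + _)%E).
move=> /fine_le_sum[||fx gyz FM] //; rewrite !addr0 in FM.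
have f0 := fine_ge0 (f_ge0 (x 0%N)).
have g0 := fine_ge0 (g_ge0 (col_mx (y 0%N) (z 0%N))).
have fM : (f (x 0%N) <= M%:E)%E by apply: ge0_le_fin => //; lra.
have gM : (g (col_mx (y 0%N) (z 0%N)) <= M%:E)%E by apply: ge0_le_fin => //; lra.
have F : (f (x 0%N) + g (col_mx (A *m x 0%N)%R (z 0%N)) <= (2 * M + 1)%:E)%E.
  rewrite -y0E; apply: le_trans (leeD fM gM) _.
  by rewrite -EFinD lee_fin; lra.
have [xr zr] := bb_level bounds F; have [a0 _ _ _ _] := bb_ge0 bounds.
have yr : enorm (y 0%N) <= a * r0 + 2.
  rewrite y0E; apply: le_trans (bb_mul bounds _) _.
  by have : a * enorm (x 0%N) <= a * r0 by [rewrite ler_wpM2l]; lra.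
have [_ S0] := bb_zmap bounds gM Zz yr zr.
rewrite -(bc_z_init admm) in S0.
have [_ Sr _] := S0.
have [/andP[/ltW d0 _]] := bb_margin bounds.
split; rewrite ?subrr ?enorm0 ?ler01 //.
- exact: bc_z_init admm.
- by rewrite y0E subrr enorm0.
- by rewrite scaler0 addr0 (bc_lam_init admm).
- exact: bc_z_init admm.
rewrite /merit /= subrr enorm0 expr0n mulr0 addr0 /rL /rlagrangian -y0E subrr.
by rewrite /penalty enorm0 expr0n mulr0 dot0r !addr0.
Qed.

(** * Stationarity residuals in terms of the step lengths *)

(** Optimality holds at [(y k.+1, z k)] or [(y k.+1, z k.+1)] instead of [(A *m x k.+1, z k.+1)].
    The gap and the change of [z] bound the discrepancy; the gap brings in the previous y-step. [C]
    depends on [beta] but not on [k]. *)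
Lemma residuals k : admm_inv k ->
  let s := enorm (x k.+1 - x k) + enorm (y k.+1 - y k) + enorm (y k - y k.-1) in
  let C := a' * (Lg * (K / beta + Lz) + betay + beta) + betax + Lg * (K / beta) in
  [/\ 0 <= s, 0 <= C,
      enorm (grad f (x k.+1) + A^T *m grad_y g (A *m x k.+1) (z k.+1)) <= C * s
    & (Defs.edist (limiting_normal_cone Z (z k.+1))
        (- grad_z g (A *m x k.+1) (z k.+1))%R <= (C * s)%:E)%E].
Proof.
move=> I s C.
have [_ a'0 _ _ _] := bb_ge0 bounds.
have [[gA rA]] := near_level I.
have [fx' _ _] := inv_x_step I; have [gy' dy _] := inv_y_step I.
have [_ [gz' zr Zz'] zmin yr] := inv_z_step I.
have [gyz _ Zz] := inv_S I.
set dx := enorm (x k.+1 - x k) in s *; set dy' := enorm (y k.+1 - y k) in s *.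
set dy0 := enorm (y k - y k.-1) in s *.
have dx0 : 0 <= dx by exact: enorm_ge0.
have dy'0 : 0 <= dy' by exact: enorm_ge0.
have dy00 : 0 <= dy0 by exact: enorm_ge0.
have s0 : 0 <= s by rewrite !addr_ge0.
have dxs : dx <= s by rewrite /s -addrA lerDl addr_ge0.
have dys : dy' <= s by rewrite /s addrAC lerDr addr_ge0.
pose D := K / beta.
have D0 : 0 <= D by rewrite divr_ge0 // ltW.
have gap : enorm (A *m x k.+1 - y k.+1) <= D * s.
  rewrite gap_eq enormZ gtr0_norm ?invr_gt0 // /D mulrAC mulrC.
  rewrite ler_pM2r ?invr_gt0 //; apply: le_trans (inv_dual_increment I) _.
  by rewrite ler_wpM2l // /s -addrA lerDr.
have zz : enorm (z k.+1 - z k) <= Lz * s.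
  have [zE Sz' _ _] := inv_z_step I; have := inv_S I.
  rewrite (inv_z I) zE in Sz' * => S0.
  by apply: le_trans (bb_zlip bounds Sz' S0) _; rewrite ler_wpM2l.
pose Cx := a' * (Lg * (D + Lz) + betay + beta) + betax.
have Cx0 : 0 <= Cx.
  by rewrite addr_ge0 ?mulr_ge0 ?addr_ge0 ?mulr_ge0 ?addr_ge0 // ltW.
have LD0 : 0 <= Lg * D by rewrite mulr_ge0.
have CE : C * s = Cx * s + Lg * D * s by rewrite -mulrDl.
have C0 : 0 <= C by rewrite /C -/D -/Cx addr_ge0.
split => //.
  apply: (@le_trans _ _ (Cx * s)); last first.
    by rewrite CE lerDl mulr_ge0.
  rewrite (x_step_stationary f_ge0 g_ge0 (bc_f_cont H) (bc_f_diff H) fx'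
    (le_fin_lt_pinfty gyz) (bc_x_local admm k)).
  (* Replacing [y k] by [y k.+1] in the residual produces [lam k.+1], which is known explicitly. *)
  have E : beta *: (A *m x k.+1 - y k) + lam k =
      grad_y g (y k.+1) (z k) + (betay + beta) *: (y k.+1 - y k).
    rewrite scalerDl addrA -(inv_lam_step I) (bc_lam_step admm).
    by rewrite -addrA -scalerDr subrKA addrC.
  rewrite E opprD addrAC -mulmxN -mulmxDr.
  apply: le_trans (enormD _ _) _; rewrite enormN enormZ (gtr0_norm betax_gt0).
  apply: (@le_trans _ _ (a' * ((Lg * (D + Lz) + betay + beta) * s) + betax * s)).
    apply: lerD; last first.
      by rewrite ler_wpM2l // ltW.
    apply: le_trans (bb_tr bounds _) _; rewrite ler_wpM2l //.
    rewrite opprD addrAC [X in enorm (X - _)]addrC.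
    apply: le_trans (enormD _ _) _.
    have := grad_y_lip gA rA (level_widen gy') (radius_widen yr).
    rewrite enormN enormZ gtr0_norm ?addr_gt0 // -/dy'.
    move: gap zz => /(ler_wpM2l Lg_ge0) + /(ler_wpM2l Lg_ge0).
    have : (betay + beta) * dy' <= (betay + beta) * s.
      by rewrite ler_wpM2l // addr_ge0 // ltW.
    lra.
  by rewrite /Cx -/D; lra.
(* The competitor is the exact normal at [(y k.+1, z k.+1)]; its error is at most [Lg] times the
   gap. *)
apply: ereal_inf_le; exists (enorm (- grad_z g (y k.+1) (z k.+1)
  - - grad_z g (A *m x k.+1) (z k.+1)))%:E.
  exists (- grad_z g (y k.+1) (z k.+1)) => //.
  exact: (z_step_normal g_ge0 (bc_g_cont H) (bc_g_C2 H) (le_fin_lt_pinfty gz')).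
rewrite lee_fin CE; apply: (@le_trans _ _ (Lg * D * s)); last first.
  by rewrite lerDr mulr_ge0.
rewrite opprK addrC /grad_z -linearB; apply: le_trans (enorm_dsubmx _) _.
apply: le_trans (bb_lip bounds gA rA (level_widen gz') (radius_widen zr)) _.
rewrite -mulrA ler_wpM2l // opp_col_mx add_col_mx subrr.
by apply: le_trans (enorm_col_mx_le _ _) _; rewrite enorm0 addr0.
Qed.

End iteration.

(** * From summable decrements to a rate *)

Lemma exists_le_mean (R : realType) (e : nat -> R) (S : R) N :
  \sum_(j < N.+1) e j <= S -> exists2 j, (j <= N)%N & e j <= S / N.+1%:R.
Proof.
move=> eS; apply: contrapT => H.
have : \sum_(j < N.+1) (S / N.+1%:R) < \sum_(j < N.+1) e j.
  apply: ltr_sum => [|j _]; first by apply/hasP; exists ord0; rewrite ?mem_index_enum.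
  by rewrite ltNge; apply/negP => ej; apply: H; exists j; rewrite // -ltnS.
rewrite sumr_const card_ord -[ltLHS]mulr_natr divfK ?pnatr_eq0 //.
by rewrite ltNge eS.
Qed.

(** Needed because a residual involves two consecutive steps. *)
Lemma sum_consecutive_le (R : realType) (e : nat -> R) (S : R) N :
  (forall j, 0 <= e j) -> (forall k, \sum_(j < k) e j <= S) ->
  \sum_(j < N) (e j + e j.+1) <= 2 * S.
Proof.
move=> e0 eS; rewrite big_split mulr_natl mulr2n; apply: lerD => //.
apply: le_trans (eS N.+1); rewrite [leRHS]big_ord_recl /= lerDr; exact: e0.
Qed.

Lemma telescoping_sum_le (R : realType) (phi e : nat -> R) k :
  (forall j, phi j.+1 + e j <= phi j) -> \sum_(j < k) e j <= phi 0%N - phi k.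
Proof.
move=> H; elim: k => [|k IH]; first by rewrite big_ord0 subrr.
by rewrite big_ord_recr /=; have := H k; lra.
Qed.

Lemma inverse_square_rate (R : realType) (u : nat -> R) (S : R) :
  (forall k, 0 <= u k) -> 0 <= S ->
  (forall N, exists2 k, (k <= N.+1)%N & u k ^+ 2 <= S / N.+1%:R) ->
  forall eps, 0 < eps -> eps <= 1 ->
    exists2 k : nat, k.+1%:R <= (S + 2) * eps ^- 2 & u k <= eps.
Proof.
move=> u0 S0 H eps eps0 eps1.
have e2 : 0 < eps ^+ 2 by rewrite exprn_gt0.
have Se : 0 <= S / eps ^+ 2 by rewrite divr_ge0 // ltW.
have /andP[tl tu] := truncn_itv Se.
(* With [N] the integer part of [S / eps ^+ 2], one has [S / N.+1 < eps ^+ 2], while [k.+1 <= N + 2]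
   is within budget as [eps <= 1]. *)
have [k kN uk] := H (Num.truncn (S / eps ^+ 2)).
exists k.
  apply: (@le_trans _ _ (S / eps ^+ 2 + 2)).
    apply: (@le_trans _ _ (Num.truncn (S / eps ^+ 2)).+2%:R).
      by rewrite ler_nat ltnS.
    by rewrite -addn2 natrD lerD2r.
  rewrite mulrDl lerD2l ler_peMr // invf_ge1 // expr_le1 //; exact: ltW.
rewrite -ler_sqr ?nnegrE ?u0 ?(ltW eps0) //; apply: le_trans uk _.
rewrite ler_pdivrMr // mulrC -ler_pdivrMr //; exact: ltW.
Qed.

(** * Choice of the thresholds and assembly of the rate *)

Theorem theorem5 (R : realType) (n m l : nat)
    (f : 'cV[R]_n -> \bar R) (g : 'cV[R]_(m + l) -> \bar R)
    (A : 'M[R]_(m, n)) (Z : set 'cV[R]_l)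
    (x0 : 'cV[R]_n) (z0 : 'cV[R]_l)
    (H : bc_assumption f g A Z x0 z0) :
  exists Bx By : R, 0 < Bx /\ 0 < By /\
    forall betax betay : R, Bx <= betax -> By <= betay ->
    exists B : R, 0 < B /\
      forall beta : R, B <= beta ->
      forall (x : nat -> 'cV[R]_n) (y : nat -> 'cV[R]_m)
             (z : nat -> 'cV[R]_l) (lam : nat -> 'cV[R]_m),
        bc_admm f g A Z x0 beta betax betay x y z lam ->
        (forall k : nat, (f (x k) + g (col_mx (A *m x k)%R (z k)) < +oo)%E) /\
        exists C : R, forall eps : R, 0 < eps -> eps <= 1 ->
          exists k : nat, k%:R <= C * eps ^- 2 /\
            eps_stationary f g A Z eps (x k) (z k).
Proof.
have f0 := bc_f_ge0 H; have g0 := bc_g_ge0 H.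
(* [M - 1] is the objective at the given feasible pair; replacing [z0] by the minimizer over [Z] can
   only lower it. *)
have [M [M1 Zw FM]] : exists M : R, [/\ 1 <= M, Z (zmap g Z (A *m x0)) &
    (f x0 + g (col_mx (A *m x0)%R (zmap g Z (A *m x0)%R)) <= (M - 1)%:E)%E].
  have [fx gz] : (f x0 < +oo)%E /\ (g (col_mx (A *m x0) z0) < +oo)%E.
    by split; apply: le_lt_trans (bc_feasible H); rewrite ?leeDl ?leeDr.
  have r_gt0 : 0 < enorm (col_mx (A *m x0) z0) + 1.
    by rewrite ltr_wpDl ?enorm_ge0.
  have M_gt0 : 0 < fine (g (col_mx (A *m x0) z0)) + 1.
    by rewrite ltr_wpDl ?fine_ge0.
  have [rbar rP] := bc_zmap H r_gt0 M_gt0.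
  have [|ex [_ _ Zw]] := rP (A *m x0) z0.
    split; [|by rewrite lerDl|exact: bc_z0 H].
    by rewrite [leLHS](ge0_fineE (g0 _) gz) lee_fin lerDl.
  have gw := (zargminP _ g0 Zw).1 (zmap_argmin ex).1 z0 (bc_z0 H).
  exists (fine (f x0) + fine (g (col_mx (A *m x0) z0)) + 1); split => //.
    by rewrite lerDr addr_ge0 ?fine_ge0.
  rewrite addrK EFinD -(ge0_fineE (f0 _) fx) -(ge0_fineE (g0 _) gz).
  exact: leeD.
have [a [a' [r0 [r [d [G [Lg [Lz bounds]]]]]]]] := bc_bounds_exist H M1.
(* [betax >= 1] serves only the comparison of squared steps with decrements; [betay >= 2 * M] also
   keeps y-steps short. *)
exists 1, (2 * M); split => //; split; first lra.
move=> betax betay bx by_.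
have betay_gt0 : 0 < betay by lra.
pose Lam := G + betay; pose K := Lg * (1 + Lz) + betay; pose c := 2 * K ^+ 2.
have [_ _ G0 Lg0 Lz0] := bb_ge0 bounds.
have [/andP[d0 _]] := bb_margin bounds.
have Lam0 : 0 <= Lam by rewrite addr_ge0 // ltW.
have c0 : 0 <= c by rewrite mulr_ge0 ?sqr_ge0.
have t1 : 0 <= Lam ^+ 2 by exact: sqr_ge0.
have t2 : 0 <= 2 * Lam / d by rewrite divr_ge0 ?mulr_ge0 // ltW.
have t3 : 0 <= 8 * c / betay by rewrite divr_ge0 ?(ltW betay_gt0) // mulr_ge0.
(* Each nonnegative summand enforces one requirement on [beta]; the 1 makes it positive. *)
exists (1 + Lam ^+ 2 + 2 * Lam / d + 8 * c / betay); split; first lra.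
move=> beta hb x y z lam admm.
have beta_gt0 : 0 < beta by lra.
have hb1 : Lam ^+ 2 <= beta by lra.
have hb2 : 2 * Lam <= d * beta by rewrite [leRHS]mulrC -ler_pdivrMr //; lra.
have hb3 : 8 * c <= beta * betay by rewrite -ler_pdivrMr //; lra.
have betax_gt0 : 0 < betax by lra.
have I k : admm_inv f g A Z M r d Lg Lz beta betay x y z lam k.
  elim: k => [|k IH].
    exact: (inv_0 H bounds admm Zw FM).
  exact: (inv_succ H bounds admm).
split=> [k|]; first exact: le_fin_lt_pinfty (inv_F (I k)).
have res k := residuals H bounds admm M1 betax_gt0 by_ beta_gt0 hb1 hb2 (I k).
pose C := a' * (Lg * (K / beta + Lz) + betay + beta) + betax + Lg * (K / beta).
pose s k := enorm (x k.+1 - x k) + enorm (y k.+1 - y k) + enorm (y k - y k.-1).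
have C0 : 0 <= C by case: (res 0%N).
have s0 k : 0 <= s k by case: (res k).
pose e k := betax / 2 * enorm (x k.+1 - x k) ^+ 2
  + betay / 4 * enorm (y k.+1 - y k) ^+ 2.
have e0 k : 0 <= e k.
  by rewrite addr_ge0 // mulr_ge0 ?sqr_ge0 // divr_ge0 // ltW.
(* The decrements telescope to at most [(M - 1) + 1 / 2]. *)
have eM k : \sum_(j < k) e j <= M.
  have desc j := inv_descent H bounds admm M1 betax_gt0 by_ beta_gt0 hb1 hb3 (I j).
  apply: le_trans (telescoping_sum_le k desc) _.
  have := inv_merit (I 0%N).
  by have := merit_lower H bounds M1 by_ beta_gt0 hb1 (I k); lra.
(* The square of a sum of three terms costs a factor 3, and each squared step is at most twice its
   share of the decrements. The shift to [j.+1] puts the lagged y-step into [e j]. *)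
have se j : s j.+1 ^+ 2 <= 6 * (e j + e j.+1).
  rewrite /s /e /=.
  have hx := sqr_ge0 (enorm (x j.+1 - x j)).
  move: (enorm (x j.+2 - x j.+1)) (enorm (y j.+2 - y j.+1)) => u v.
  move: (enorm (y j.+1 - y j)) => w.
  have := mulr_ge0 (ltW betax_gt0) hx.
  have : u ^+ 2 <= betax * u ^+ 2 by rewrite ler_peMl ?sqr_ge0.
  have : 2 * v ^+ 2 <= betay * v ^+ 2 by rewrite ler_wpM2r ?sqr_ge0 //; lra.
  have : 2 * w ^+ 2 <= betay * w ^+ 2 by rewrite ler_wpM2r ?sqr_ge0 //; lra.
  have := sqr_ge0 (u - v); have := sqr_ge0 (u - w); have := sqr_ge0 (v - w).
  nra.
have S0 : 0 <= 12 * C ^+ 2 * M.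
  by rewrite mulr_ge0 ?mulr_ge0 ?sqr_ge0 //; lra.
exists (12 * C ^+ 2 * M + 2) => eps eps0 eps1.
have [|N|k kC Cs] :=
    @inverse_square_rate _ (fun k => C * s k) _ _ S0 _ eps eps0 eps1.
- by move=> k; rewrite mulr_ge0.
- have [j jN ej] := exists_le_mean (e := fun j => e j + e j.+1)
    (sum_consecutive_le N.+1 e0 eM).
  exists j.+1 => //; rewrite exprMn.
  apply: (@le_trans _ _ (C ^+ 2 * (6 * (e j + e j.+1)))).
    by rewrite ler_wpM2l ?sqr_ge0.
  have -> : 12 * C ^+ 2 * M / N.+1%:R = C ^+ 2 * (6 * (2 * M / N.+1%:R)).
    by ring.
  by rewrite ler_wpM2l ?sqr_ge0 // ler_wpM2l.
(* [s k] controls the residuals at iterate [k.+1], which is why the rate counts [k.+1]. *)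
exists k.+1; split => //.
have [_ _ rx rz] := res k; have [_ _ Zz] := inv_S (I k.+1).
split => //; first exact: le_fin_lt_pinfty (inv_F (I k.+1)).
  exact: le_trans rx Cs.
by apply: le_trans rz _; rewrite lee_fin.
Qed.
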